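(* Let $d\ge1$ and consider the kinetically constrained model (KCM) on $\mathbb Z^d$ with update family $\mathcal X$ contained in a half-space, i.e. such that there exists $u\in\mathbb R^d$ with $\langle x,u\rangle<0$ for all $X\in\mathcal X$ and all $x\in X$. Let $$q_{\mathrm c}=\inf\left\{q\in[0,1]:\lim_{t\to\infty}\mu_q(\eta_0(t)\neq1)=0\right\},$$ where $\eta$ is the bootstrap percolation with the same update family $\mathcal X$ and i.i.d. Bernoulli($q$) initial condition, with law $\mu_q$. Then the spectral gap of the generator of the KCM with parameter $q$ is positive for all $q>q_{\mathrm c}$ and is $0$ for all $q<q_{\mathrm c}$.
   Context: An update family is a finite family $\mathcal X$ of finite subsets of $\mathbb Z^d\setminus\{0\}$ (both the family and the sets in it may be empty). Bootstrap percolation with update family $\mathcal X$ is the discrete-time deterministic process on $\{0,1\}^{\mathbb Z^d}$ in which, at each time step, simultaneously for all sites, the state of $x\in\mathbb Z^d$ becomes $1$ if it is already $1$ or there exists $X\in\mathcal X$ such that all elements of $x+X$ are in state $1$; otherwise it is $0$. Its configuration at time $t$ is $\eta(t)$, and $\eta_0(t)$ is the state of the origin at time $t$. The KCM with update family $\mathcal X$ and parameter $q\in[0,1]$ is the continuous-time Markov process on $\{0,1\}^{\mathbb Z^d}$ in which each site $x$ attempts, at rate $1$, to update its state to an independent Bernoulli variable of parameter $q$, the update being performed only if there is $X\in\mathcal X$ such that all elements of $x+X$ are in state $1$. Let $\pi_q$ be the product Bernoulli($q$) measure on $\{0,1\}^{\mathbb Z^d}$, with respect to which the process is reversible. The generator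 acts on functions $f$ depending on finitely many sites by $\mathcal Lf(\sigma)=\sum_{x\in\mathbb Z^d}c_x(\sigma)\,(\pi_{q,x}(f)(\sigma)-f(\sigma))$, where $c_x(\sigma)=1$ if some $X\in\mathcal X$ satisfies $\sigma_{x+y}=1$ for all $y\in X$, $c_x(\sigma)=0$ otherwise, and $\pi_{q,x}(f)$ is the average of $f$ over $\sigma_x\sim$ Bernoulli($q$) with the other coordinates fixed. The spectral gap is $\inf_f \dfrac{-\pi_q(f\mathcal Lf)}{\mathrm{Var}_{\pi_q}(f)}$, the infimum being over functions $f$ depending on finitely many sites with $\mathrm{Var}_{\pi_q}(f)>0$.
   Formalization: The vanishing of the spectral gap is stated for 0 < q < q_c only: at q = 0 every variance is zero, so the infimum defining the gap is over the empty set (+∞ by convention) and the claim ''gap is 0'' fails there. *)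

(* Defs.v *)
From HB Require Import structures.
From mathcomp Require Import all_boot all_order all_algebra finmap.
From mathcomp Require Import all_classical all_reals all_analysis measurable_realfun.
From mathcomp Require Import ring.

Set Implicit Arguments.
Unset Strict Implicit.
Unset Printing Implicit Defensive.

Import Order.TTheory GRing.Theory Num.Theory.
Import numFieldNormedType.Exports.

Local Open Scope classical_set_scope.
Local Open Scope ring_scope.

Definition coordinate_events (I : Type) : set (set (I -> bool)) :=
  \bigcup_(x in [set: I])
    preimage_set_system setT (fun s : I -> bool => s x) measurable.

(* {0,1}^I with its product sigma-algebra. *)
Definition config (I : Type) := g_sigma_algebraType (@coordinate_events I).

(* The product measure is realized as the law of a measurable coding of a
   uniform point of [0, 1[: the current interval is split in proportions
   p : 1 - p and the n-th digit tells which piece contains the point. *)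
Section coding.
Context {R : realType} (p : R).
Hypothesis p01 : 0 <= p <= 1.

Fixpoint digit (a b : R) (n : nat) (w : R) : bool :=
  let m := a + p * (b - a) in
  if n is n'.+1 then (if w < m then digit a m n' w else digit m b n' w)
  else w < m.

Let lam : {measure set (measurableTypeR R) -> \bar R} := lebesgue_measure.

Lemma measurable_digit a b n :
  measurable_fun [set: measurableTypeR R] (digit a b n).
Proof.
elim: n a b => [|n IHn] a b /=.
  by apply: measurable_fun_ltr => //; exact: measurable_cst.
apply: measurable_fun_ifT => //.
by apply: measurable_fun_ltr => //; exact: measurable_cst.
Qed.

Let weight (B : set bool) : R :=
  p * (true \in B)%:R + (1 - p) * (false \in B)%:R.

Let event a b (B : nat -> set bool) n : set R :=
  `[a, b[ `&` [set w | forall k, (k < n)%N -> B k (digit a b k w)].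

Lemma measurable_digit_event a b (B : nat -> set bool) n :
  measurable (event a b B n : set (measurableTypeR R)).
Proof.
apply: measurableI; first exact: measurable_itv.
rewrite [X in measurable X](_ : _ =
    \bigcap_(k in `I_n) (digit a b k @^-1` B k)) //.
apply: bigcap_measurableType => k _; rewrite -[X in measurable X]setTI.
exact: measurable_digit.
Qed.

Lemma lebesgue_digit a b (B : nat -> set bool) n : a <= b ->
  lam (event a b B n) = ((b - a) * \prod_(k < n) weight (B k))%:E.
Proof.
elim: n a b B => [|n IHn] a b B ab.
  rewrite big_ord0 mulr1 /event.
  rewrite [X in _ `&` X](_ : _ = setT); last first.
    by apply/seteqP; split.
  rewrite setIT; apply: (etrans (lebesgue_measure_itv `[a, b[)).
  rewrite /= lte_fin.
  case: ltP => [_|ba]; first by rewrite EFinB.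
  by rewrite (@le_anti _ _ a b) ?subrr// ab.
have /andP[p0 p1] := p01.
set m := a + p * (b - a).
have am : a <= m by rewrite lerDl mulr_ge0// subr_ge0.
have mb : m <= b.
  have -> : b = a + 1 * (b - a) by rewrite mul1r addrC subrK.
  by rewrite lerD2l ler_wpM2r// subr_ge0.
pose B' k := B k.+1.
pose L := if true \in B 0 then event a m B' n else set0.
pose H := if false \in B 0 then event m b B' n else set0.
have EL : event a b B n.+1 = L `|` H.
  apply/seteqP; split=> w.
    rewrite /event /= in_itv/= => -[/andP[aw wb] Bw].
    have B0 := Bw 0%N isT; rewrite /= -/m in B0.
    case: (ltP w m) => wm.
      left; rewrite wm in B0; rewrite /L (mem_set B0).
      split; first by rewrite /= in_itv/= aw.
      by move=> k kn; have := Bw k.+1 kn; rewrite /= -/m wm.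
    right; rewrite ltNge wm /= in B0; rewrite /H (mem_set B0).
    split; first by rewrite /= in_itv/= wm.
    by move=> k kn; have := Bw k.+1 kn; rewrite /= -/m ltNge wm.
  rewrite /L /H; case=> [|]; case: ifPn => //= B0.
    rewrite /event /= !in_itv/= => -[/andP[aw wm] Bw].
    split; first by rewrite aw (lt_le_trans wm).
    by case=> [_|k kn] /=; rewrite -/m wm; [exact: set_mem|exact: Bw].
  rewrite /event /= !in_itv/= => -[/andP[mw wb] Bw].
  split; first by rewrite wb (le_trans am).
  by case=> [_|k kn] /=; rewrite -/m ltNge mw /=; [exact: set_mem|exact: Bw].
have LH : L `&` H = set0.
  apply/seteqP; split=> // w; rewrite /L /H.
  case: ifPn => // _; case: ifPn => _ [] //.
  rewrite /event /= !in_itv/= => -[/andP[_ wm] _] [/andP[mw _] _].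
  by move: wm; rewrite ltNge mw.
have mL : measurable (L : set (measurableTypeR R)).
  rewrite /L; case: ifPn => _; last exact: measurable0.
  exact: measurable_digit_event.
have mH : measurable (H : set (measurableTypeR R)).
  rewrite /H; case: ifPn => _; last exact: measurable0.
  exact: measurable_digit_event.
rewrite EL; transitivity (lam L + lam H)%E; first exact: measureU.
have -> : lam L = ((true \in B 0)%:R * (p * (b - a)
                     * \prod_(k < n) weight (B' k)))%:E.
  rewrite /L; case: (true \in B 0); last by rewrite measure0 mul0r.
  by rewrite IHn//=; congr EFin; rewrite /m; ring.
have -> : lam H = ((false \in B 0)%:R * ((1 - p) * (b - a)
                     * \prod_(k < n) weight (B' k)))%:E.
  rewrite /H; case: (false \in B 0); last by rewrite measure0 mul0r.
  by rewrite IHn//=; congr EFin; rewrite /m; ring.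
rewrite -EFinD big_ord_recl /weight; congr EFin.
rewrite (eq_bigr (fun k : 'I_n => weight (B' k)))//.
set Q := \prod_(k < n) _.
by ring.
Qed.

End coding.

Section unit_lebesgue.
Context {R : realType}.

Let measurable_unit : measurable (`[0, 1[ : set (measurableTypeR R)).
Proof. exact: measurable_itv. Qed.

Definition unit_lebesgue : set (measurableTypeR R) -> \bar R :=
  mrestr lebesgue_measure measurable_unit.

HB.instance Definition _ := Measure.on unit_lebesgue.

Let unit_lebesgue_setT : unit_lebesgue setT = 1%E.
Proof.
rewrite /unit_lebesgue /mrestr setTI.
apply: (etrans (lebesgue_measure_itv `[0, 1[)).
by rewrite /= lte_fin ltr01 sube0.
Qed.

HB.instance Definition _ :=
  Measure_isProbability.Build _ _ _ unit_lebesgue unit_lebesgue_setT.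

End unit_lebesgue.

Section product_probability.
Context {R : realType} (I : countType) (m : probability bool R).

Lemma exists_product_probability : exists P : probability (config I) R,
  forall (S : {fset I}) (A : I -> set bool),
    P [set s : config I | forall x, x \in S -> A x (s x)] =
    (\prod_(x <- S) m (A x))%E.
Proof.
pose p := fine (m [set true]).
have m_fin A : m A \is a fin_num by apply: fin_num_measure.
have mp A : m A = (p * (true \in A)%:R + (1 - p) * (false \in A)%:R)%:E.
  have mt : m [set true] = p%:E by rewrite /p fineK.
  have mf : m [set false] = (1 - p)%:E.
    rewrite (_ : [set false] = ~` [set true]); last first.
      by apply/seteqP; split=> -[] //= /(_ erefl).
    by rewrite probability_setC// mt EFinB.
  have -> : m A = (m (A `&` [set true]) + m (A `&` [set false]))%E.
    rewrite -measureU//.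
      by rewrite -setIUr -setT_bool setIT.
    by apply/seteqP; split=> // -[] [] [_ /= ?] [_ /= ?].
  have int b : m (A `&` [set b]) = (m [set b] * (b \in A)%:R%:E)%E.
    case: (boolP (b \in A)) => bA.
      rewrite mule1; congr (m _); apply/seteqP; split=> [c []//|c /= ->].
      by split=> //; exact: set_mem.
    rewrite mule0 (_ : _ `&` _ = set0) ?measure0//.
    apply/seteqP; split=> // c [/= Ac cb]; move: bA.
    by rewrite -cb mem_set.
  by rewrite !int mt mf -!EFinM -EFinD.
have p01 : 0 <= p <= 1.
  rewrite /p -lee_fin -[X in _ && X]lee_fin fineK//.
  by rewrite measure_ge0 probability_le1.
pose code (w : measurableTypeR R) : config I :=
  fun x => digit p 0 1 (choice.pickle x) w.
have mcode : measurable_fun setT code.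
  apply: (@measurability _ _ (measurableTypeR R) (config I) setT code
            (@coordinate_events I) erefl).
  move=> _ [_ [x _ [B mB <-]] <-].
  rewrite !setTI -[X in measurable X]setTI.
  exact: (measurable_digit p 0 1 (choice.pickle x)).
pose X : {mfun measurableTypeR R >-> config I} :=
  HB.pack code (isMeasurableFun.Build _ _ _ _ code mcode).
exists (distribution unit_lebesgue X) => S A.
pose N := (\max_(x <- S) (choice.pickle x).+1)%N.
pose B k : set bool := [set b | forall x, x \in S -> choice.pickle x = k -> A x b].
have BA x : x \in S -> B (choice.pickle x) = A x.
  move=> xS; apply/seteqP; split=> [b /(_ x xS erefl)//|b Ab y yS].
  by move=> /(pcan_inj choice.pickleK) ->.
have SN x : x \in S -> (choice.pickle x < N)%N.
  move=> xS; have xS' : x \in enum_fset S by [].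
  exact: (@leq_bigmax_seq _ (enum_fset S) xpredT
            (fun x => (choice.pickle x).+1) x xS' isT).
transitivity (lebesgue_measure (`[0, 1[ `&` [set w | forall k, (k < N)%N ->
    B k (digit p 0 1 k w)])).
  rewrite /distribution /pushforward /unit_lebesgue /mrestr setIC.
  congr (lebesgue_measure (_ `&` _)).
  apply/seteqP; split=> w /= Hw.
    by move=> k kN x xS xk; rewrite -xk; exact: Hw.
  by move=> x xS; apply: Hw => //; exact: SN.
rewrite lebesgue_digit// subr0 mul1r -prodEFin.
under eq_bigr do rewrite -mp.
rewrite -(big_mkord xpredT (fun k => m (B k))).
rewrite (bigID (mem (map choice.pickle S)))/= [X in (_ * X)%E]big1 ?mule1; last first.
  move=> k kS; rewrite (_ : B k = setT) ?probability_setT//.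
  apply/seteqP; split=> // b _ x xS xk; move: kS.
  by rewrite -xk map_f.
rewrite -big_filter (perm_big (map choice.pickle S)); last first.
  apply: uniq_perm.
  - by rewrite filter_uniq// iota_uniq.
  - by rewrite map_inj_uniq ?fset_uniq//; exact: (pcan_inj choice.pickleK).
  move=> k; rewrite mem_filter mem_index_iota /=.
  by apply/andb_idr => /mapP[x xS ->]; exact: SN.
by rewrite big_map; apply: eq_big_seq => x xS; rewrite BA.
Qed.

(* The product of copies of m, determined by product_probabilityE since the
   events there form a pi-system generating the sigma-algebra of config I. *)
Definition product_probability : probability (config I) R :=
  projT1 (cid exists_product_probability).

Lemma product_probabilityE (S : {fset I}) (A : I -> set bool) :
  product_probability [set s : config I | forall x, x \in S -> A x (s x)] =
  (\prod_(x <- S) m (A x))%E.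
Proof. exact: (projT2 (cid exists_product_probability)). Qed.

End product_probability.

Section kcm.
Context {R : realType} {d : nat}.
Local Notation site := 'rV[int]_d.
Implicit Types (XX : {fset {fset site}}) (s : config site) (x : site).

Definition update_family XX : Prop :=
  forall X : {fset site}, X \in XX -> 0 \notin X.

Definition in_half_space XX : Prop :=
  exists u : 'rV[R]_d, forall (X : {fset site}) (x : site),
    X \in XX -> x \in X -> \sum_(i < d) (x 0 i)%:~R * u 0 i < 0.

Definition bernoulli_product (q : R) : probability (config site) R :=
  product_probability site (bernoulli_prob q).

Definition constraint XX s x : bool :=
  has (fun X : {fset site} => all (fun y : site => s (x + y)) X) XX.

Definition bootstrap_step XX s : config site :=
  fun x => s x || constraint XX s x.

Definition bootstrap XX (t : nat) s : config site :=
  iter t (bootstrap_step XX) s.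

Definition q_c XX : R :=
  inf [set q : R | 0 <= q <= 1 /\
    (fun t => bernoulli_product q [set s | bootstrap XX t s 0 != true])
      @ \oo --> 0%E].

Definition local_function (f : config site -> R) : Prop :=
  exists S : {fset site}, forall s s' : config site,
    (forall x, x \in S -> s x = s' x) -> f s = f s'.

Definition site_average (q : R) x (f : config site -> R) s : R :=
  \sum_(b : bool) bernoulli_pmf q b * f [eta s with x |-> b].

(* The sum is the finite-support one: for local f, only the sites of the
   support of f can contribute. *)
Definition generator XX (q : R) (f : config site -> R) s : R :=
  \sum_(x \in [set: site])
    (constraint XX s x)%:R * (site_average q x f s - f s).

(* Extended-real infimum: it is +oo when no local function has positive
   variance, that is, for q = 0 and q = 1. *)
Definition spectral_gap XX (q : R) : \bar R :=
  let pi_q := bernoulli_product q in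
  ereal_inf [set (- 'E_pi_q[f \* generator XX q f] / 'V_pi_q[f])%E
            | f in [set f | local_function f /\ (0 < 'V_pi_q[f])%E]].

End kcm.

(* Main.v *)
Require Import Defs.
From mathcomp Require Import all_boot all_order all_algebra finmap.
From mathcomp Require Import all_classical all_reals all_analysis.
From mathcomp Require Import measurable_realfun ring lra zify.

(** A real direction of the half-space can be replaced by an integer one, which
    gives each site a height such that the constraint at [x] only looks at
    strictly higher sites.  Let [theta n q] be the probability that the origin
    stays unfilled when only the sites of height at most [n] that can influence
    it are used.

    Above criticality.  Reading sites from the top and skipping those whose
    constraint is already met decides the event defining [theta k] while reading
    [x] with probability at most [theta (k - ht x) q / (1 - q)].  The OSSS
    inequality and Russo's formula then give
    [n * theta n <= 2 (theta 0 + ... + theta (n - 1)) * (- theta n')], which forces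
    superpolynomial decay for [q > q_c].  Hence, for the dynamics in which [x] is
    updated as soon as its constraint can be met by filling a large enough finite
    cone above it, the constraints fail with a probability that is small
    compared to the inverse size of the cone; orienting the martingale
    decomposition of the variance yields a Poincaré inequality for it, and legal
    paths inside the cone transfer it to the original dynamics.

    Below criticality.  The event that the origin is unfilled in the cone of
    height [n] is invariant, and of probability bounded below.  Running the finite
    volume dynamics from [s 0] therefore keeps the variance bounded below, while
    the Dirichlet form has to become small at some time linear in the volume;
    finite speed of propagation makes the boundary terms negligible. *)

Set Implicit Arguments.
Unset Strict Implicit.
Unset Printing Implicit Defensive.

Import Order.TTheory GRing.Theory Num.Theory.
Import numFieldNormedType.Exports.

Local Open Scope classical_set_scope.
Local Open Scope ring_scope.

(** * Averages over finitely many sites *)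

Section update.
Context {T : eqType}.
Implicit Types (s : T -> bool) (x y : T).

Definition upd s x (b : bool) : T -> bool := [eta s with x |-> b].

Lemma updE s x b y : upd s x b y = if y == x then b else s y.
Proof. by []. Qed.

Lemma upd_same s x b : upd s x b x = b.
Proof. by rewrite updE eqxx. Qed.

Lemma upd_id s x : upd s x (s x) = s.
Proof. by apply/funext => y; rewrite updE; case: eqP => [->|]. Qed.

Lemma updK s x b c : upd (upd s x b) x c = upd s x c.
Proof. by apply/funext => y; rewrite !updE; case: eqP. Qed.

Lemma updC s x y b c : x != y -> upd (upd s x b) y c = upd (upd s y c) x b.
Proof.
by move=> xy; apply/funext => z; rewrite !updE; case: eqVneq => // ->;
  rewrite eq_sym (negPf xy).
Qed.

End update.

Section average.
Context {R : realFieldType} {T : eqType}.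
Implicit Types (s : T -> bool) (x y : T) (l : seq T) (f g : (T -> bool) -> R).

Definition indep {V : Type} x (f : (T -> bool) -> V) :=
  forall s b, f (upd s x b) = f s.

Definition dep_on {V : Type} (P : pred T) (f : (T -> bool) -> V) :=
  forall s s', (forall x, P x -> s x = s' x) -> f s = f s'.

Lemma dep_on_indep (V : Type) (P : pred T) (f : (T -> bool) -> V) x :
  dep_on P f -> ~~ P x -> indep x f.
Proof.
by move=> Pf Px s b; apply: Pf => y Py; rewrite updE; case: eqP Py Px => // -> ->.
Qed.

Lemma sub_dep_on (V : Type) (P Q : pred T) (f : (T -> bool) -> V) :
  (forall x, P x -> Q x) -> dep_on P f -> dep_on Q f.
Proof. by move=> PQ Pf s s' ss'; apply: Pf => x /PQ; exact: ss'. Qed.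

Definition grad x f s : R := f (upd s x true) - f (upd s x false).

Variable q : R.

Definition avg x f s : R := q * f (upd s x true) + (1 - q) * f (upd s x false).

(** The conditional expectation given the sites outside [l]; repetitions in [l] are harmless because
    [avg x] is idempotent. *)
Definition av l f : (T -> bool) -> R := foldr avg f l.

(** This is the expectation of [f] as soon as [f] depends on the sites of [l] only; otherwise it is
    conditional on the sites outside [l] being unfilled. *)
Definition mean l f : R := av l f (fun=> false).

Lemma indep_avg x f : indep x (avg x f).
Proof. by move=> s b; rewrite /avg !updK. Qed.

Lemma indep_grad x f : indep x (grad x f).
Proof. by move=> s b; rewrite /grad !updK. Qed.

Lemma indep_gradP x f : indep x f -> forall s, grad x f s = 0.
Proof. by move=> xf s; rewrite /grad !xf subrr. Qed.

Lemma avg_indep x f : indep x f -> avg x f = f.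
Proof. by move=> xf; apply/funext => s; rewrite /avg !xf; ring. Qed.

Lemma avgK x f : avg x (avg x f) = avg x f.
Proof. exact/avg_indep/indep_avg. Qed.

Lemma avgC x y f : avg x (avg y f) = avg y (avg x f).
Proof.
have [->//|xy] := eqVneq x y.
by apply/funext => s; rewrite /avg !(updC _ _ _ xy); ring.
Qed.

Lemma grad_avg x y f : x != y -> grad x (avg y f) = avg y (grad x f).
Proof.
by move=> xy; apply/funext => s; rewrite /avg /grad !(updC _ _ _ xy); ring.
Qed.

Lemma sub_avg x f s : f s - avg x f s = ((s x)%:R - q) * grad x f s.
Proof.
rewrite /avg /grad -{1}(upd_id s x); case: (s x) => /=; ring.
Qed.

Lemma avg_sqr x f s :
  avg x (fun s => f s ^+ 2) s - avg x f s ^+ 2 = q * (1 - q) * grad x f s ^+ 2.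
Proof. by rewrite /avg /grad; ring. Qed.

Lemma av_cat l l' f : av (l ++ l') f = av l (av l' f).
Proof. by rewrite /av foldr_cat. Qed.

Lemma avg_av x l f : avg x (av l f) = av l (avg x f).
Proof. by elim: l => //= y l IH; rewrite avgC IH. Qed.

Lemma grad_av x l f : x \notin l -> grad x (av l f) = av l (grad x f).
Proof.
by elim: l => //= y l IH; rewrite inE negb_or => /andP[xy xl]; rewrite grad_avg// IH.
Qed.

Lemma avg_av_in x l f : x \in l -> avg x (av l f) = av l f.
Proof.
elim: l => //= y l IH; rewrite inE => /predU1P[->|xl]; first exact: avgK.
by rewrite avgC IH.
Qed.

Lemma av_avg_in x l f : x \in l -> av l (avg x f) = av l f.
Proof. by move=> xl; rewrite -avg_av avg_av_in. Qed.

Lemma indep_av x l f : x \in l -> indep x (av l f).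
Proof. by move=> xl; rewrite -(avg_av_in f xl); exact: indep_avg. Qed.

Lemma av_sub l l' f : {subset l <= l'} -> av l (av l' f) = av l' f.
Proof.
elim: l => //= x l IH ll'; rewrite IH ?avg_av_in//.
  by apply: ll'; rewrite mem_head.
by move=> y yl; apply: ll'; rewrite inE yl orbT.
Qed.

Lemma av_avC l l' f : av l (av l' f) = av l' (av l f).
Proof. by elim: l => //= x l IH; rewrite IH avg_av. Qed.

Lemma av_eq_mem l l' f : l =i l' -> av l f = av l' f.
Proof.
move=> ll'; transitivity (av l' (av l f)); first by rewrite av_sub// => x; rewrite ll'.
by rewrite av_avC av_sub// => x; rewrite ll'.
Qed.

Lemma indep_av_out x l f : indep x f -> indep x (av l f).
Proof. by move=> xf; rewrite -(avg_indep xf) -avg_av; exact: indep_avg. Qed.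

Lemma avD l f g : av l (fun s => f s + g s) = (fun s => av l f s + av l g s).
Proof. by elim: l => //= x l ->; apply/funext => s; rewrite /avg; ring. Qed.

Lemma avZ l c f : av l (fun s => c * f s) = (fun s => c * av l f s).
Proof. by elim: l => //= x l ->; apply/funext => s; rewrite /avg; ring. Qed.

Lemma av_cst l (c : R) : av l (fun=> c) = (fun=> c).
Proof. by elim: l => //= x l ->; apply/funext => s; rewrite /avg; ring. Qed.

Lemma avM l f g : (forall x, x \in l -> indep x g) ->
  av l (fun s => g s * f s) = (fun s => g s * av l f s).
Proof.
elim: l => //= x l IH lg; rewrite IH.
  by apply/funext => s; rewrite /avg !lg ?mem_head//; ring.
by move=> y yl; apply: lg; rewrite inE yl orbT.
Qed.

Lemma dep_on_avg (P : pred T) x f :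
  dep_on P f -> dep_on [pred y | P y & y != x] (avg x f).
Proof.
move=> Pf s s' ss'; rewrite /avg; congr (_ * _ + _ * _);
  by apply: Pf => y Py; rewrite !updE; case: eqVneq => // yx;
     apply: ss'; rewrite /= Py yx.
Qed.

Lemma dep_on_av (P : pred T) l f :
  dep_on P f -> dep_on [pred y | P y & y \notin l] (av l f).
Proof.
elim: l => /= [|x l IH] Pf.
  by apply: sub_dep_on Pf => x /= ->.
apply: sub_dep_on (dep_on_avg (x := x) (IH Pf)) => y /=.
by rewrite inE negb_or -andbA => /and3P[-> -> ->].
Qed.

Lemma av_dep_on l f s : dep_on [in l] f -> av l f s = mean l f.
Proof. by move=> /(@dep_on_av _ l) H; apply: H => x /=; rewrite andbN. Qed.

(** Lets all means be taken over one large list, whatever the supports of the integrands. *)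
Lemma mean_supp l l' f : dep_on [in l] f -> {subset l <= l'} ->
  mean l' f = mean l f.
Proof.
move=> lf ll'; rewrite {1}/mean -[av l' f](av_sub (l := l)) // av_avC.
rewrite (_ : av l f = fun=> mean l f) ?av_cst//.
by apply/funext => s; exact: av_dep_on.
Qed.

Lemma eq_mean l f g : (forall s, f s = g s) -> mean l f = mean l g.
Proof. by move=> fg; congr mean; apply/funext. Qed.

Lemma meanD l f g : mean l (fun s => f s + g s) = mean l f + mean l g.
Proof. by rewrite /mean avD. Qed.

Lemma meanZ l c f : mean l (fun s => c * f s) = c * mean l f.
Proof. by rewrite /mean avZ. Qed.

Lemma meanN l f : mean l (fun s => - f s) = - mean l f.
Proof. by rewrite -mulN1r -meanZ; apply: eq_mean => s; rewrite mulN1r. Qed.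

Lemma meanB l f g : mean l (fun s => f s - g s) = mean l f - mean l g.
Proof. by rewrite meanD meanN. Qed.

Lemma mean_cst l (c : R) : mean l (fun=> c) = c.
Proof. by rewrite /mean av_cst. Qed.

Lemma mean_sum l (I : Type) (r : seq I) (F : I -> (T -> bool) -> R) :
  mean l (fun s => \sum_(i <- r) F i s) = \sum_(i <- r) mean l (F i).
Proof.
elim: r => [|i r IH].
  by rewrite big_nil -[RHS](mean_cst l); apply: eq_mean => s; rewrite big_nil.
by rewrite big_cons -IH -meanD; apply: eq_mean => s; rewrite big_cons.
Qed.

Lemma mean_avg x l f : x \in l -> mean l (avg x f) = mean l f.
Proof. by move=> xl; rewrite /mean av_avg_in. Qed.

Lemma mean_av l l' f : {subset l <= l'} -> mean l' (av l f) = mean l' f.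
Proof. by move=> ll'; rewrite /mean av_avC av_sub. Qed.

(* Integrating over [l] first decouples [g] from [av l f]. *)
Lemma mean_indepM l l' f g : {subset l <= l'} -> dep_on [in l] g ->
  mean l' (fun s => g s * av l f s) = mean l' g * mean l' f.
Proof.
move=> ll' lg; rewrite -(mean_av _ ll').
rewrite (_ : av l _ = fun s => mean l' g * av l f s) ?meanZ ?mean_av//.
apply/funext => s.
rewrite (_ : (fun s => _) = (fun s => av l f s * g s)); last first.
  by apply/funext => s'; rewrite mulrC.
rewrite avM; last by move=> x xl; exact: indep_av.
by rewrite mulrC av_dep_on// (mean_supp lg ll').
Qed.

Hypothesis q01 : 0 <= q <= 1.

Let q0 : 0 <= q. Proof. by have /andP[] := q01. Qed.
Let q1 : 0 <= 1 - q. Proof. by have /andP[] := q01; rewrite subr_ge0. Qed.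

Lemma ler_av l f g : (forall s, f s <= g s) -> forall s, av l f s <= av l g s.
Proof.
move=> fg; elim: l => //= x l IH s.
by rewrite /avg lerD// ler_wpM2l ?q0 ?q1.
Qed.

Lemma ler_mean l f g : (forall s, f s <= g s) -> mean l f <= mean l g.
Proof. by move=> fg; exact: ler_av. Qed.

Lemma mean_ge0 l f : (forall s, 0 <= f s) -> 0 <= mean l f.
Proof. by move=> f0; rewrite -(mean_cst l 0); exact: ler_mean. Qed.

Lemma normr_av l f s : `|av l f s| <= av l (fun s => `|f s|) s.
Proof.
rewrite ler_norml; apply/andP; split; last first.
  by apply: ler_av => t; exact: ler_norm.
have -> : - av l (fun s => `|f s|) s = av l (fun s => -1 * `|f s|) s.
  by rewrite avZ mulN1r.
by apply: ler_av => t; rewrite mulN1r lerNl -normrN ler_norm.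
Qed.

Lemma av_CauchySchwarz l f g s :
  av l (fun s => f s * g s) s ^+ 2 <=
  av l (fun s => f s ^+ 2) s * av l (fun s => g s ^+ 2) s.
Proof.
set A := av l (fun s => f s ^+ 2) s; set B := av l _ s; set C := av l _ s.
have quad t : 0 <= t ^+ 2 * A - 2 * t * B + C.
  have : 0 <= av l (fun s => (t * f s - g s) ^+ 2) s.
    rewrite (_ : 0 = av l (fun=> 0) s); last by rewrite av_cst.
    by apply: ler_av => s'; exact: sqr_ge0.
  rewrite (_ : (fun s => _) = fun s => t ^+ 2 * f s ^+ 2 +
      (- (2 * t) * (f s * g s) + g s ^+ 2)); last by apply/funext => s'; ring.
  by rewrite !avD !avZ -/A -/B -/C => /le_trans; apply; lra.
have A0 : 0 <= A.
  rewrite (_ : 0 = av l (fun=> 0) s); last by rewrite av_cst.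
  by apply: ler_av => s'; exact: sqr_ge0.
have C0 : 0 <= C by have := quad 0; lra.
have [A00|An0] := eqVneq A 0; last first.
  have Apos : 0 < A by rewrite lt_def An0.
  have := quad (B / A); rewrite (_ : _ + C = (A * C - B ^+ 2) / A); last by field.
  by rewrite pmulr_lge0 ?invr_gt0// subr_ge0.
(* When [A = 0] the quadratic is affine in [t]; if [B] is nonzero, [t = (C + 1) / B] would give it
   the negative value [- C - 2]. *)
have [->|Bn0] := eqVneq B 0; first by rewrite expr0n mulr_ge0.
have := quad ((C + 1) / B); rewrite A00 (_ : _ + C = - C - 2); last by field.
by move: C0; lra.
Qed.

Lemma av_jensen l f s : av l f s ^+ 2 <= av l (fun s => f s ^+ 2) s.
Proof.
have := av_CauchySchwarz l (fun=> 1) f s.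
rewrite (_ : (fun s => 1 * f s) = f); last by apply/funext => s'; rewrite mul1r.
by rewrite (_ : (fun=> 1 ^+ 2) = fun=> 1) ?av_cst ?mul1r// expr1n.
Qed.

Lemma normr_mean l f : `|mean l f| <= mean l (fun s => `|f s|).
Proof. exact: normr_av. Qed.

Lemma mean_av_sqr l l' f : {subset l <= l'} ->
  mean l' (fun s => av l f s ^+ 2) <= mean l' (fun s => f s ^+ 2).
Proof.
by move=> ll'; rewrite -(mean_av (fun s => f s ^+ 2) ll'); apply: ler_mean => s; exact: av_jensen.
Qed.

Lemma mean_avg_sqr x l f : x \in l ->
  mean l (fun s => f s ^+ 2) - mean l (fun s => avg x f s ^+ 2) =
  q * (1 - q) * mean l (fun s => grad x f s ^+ 2).
Proof.
move=> xl; rewrite -(mean_avg (fun s => f s ^+ 2) xl) -meanB -meanZ.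
by apply: eq_mean => s; rewrite avg_sqr.
Qed.

Lemma mean_upd_true x l f : x \in l -> (forall s, 0 <= f s) ->
  q * mean l (fun s => f (upd s x true)) <= mean l f.
Proof.
move=> xl f0; rewrite -meanZ -(mean_avg f xl); apply: ler_mean => s.
by rewrite /avg lerDl mulr_ge0 ?q1.
Qed.

Lemma mean_upd_false x l f : x \in l -> (forall s, 0 <= f s) ->
  (1 - q) * mean l (fun s => f (upd s x false)) <= mean l f.
Proof.
move=> xl f0; rewrite -meanZ -(mean_avg f xl); apply: ler_mean => s.
by rewrite /avg lerDr mulr_ge0 ?q0.
Qed.

End average.

(** * The OSSS inequality *)

Section osss.
Context {R : realFieldType} {T : eqType}.
Variable q : R.
Hypothesis q01 : 0 <= q <= 1.
Implicit Types (s : T -> bool) (x y : T) (l L : seq T) (f g : (T -> bool) -> R).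

(** Where [x] is not read, [g] ignores it, and the increment [h - avg q x h] has mean zero in [x].
    Where it is read, [g] is bounded by 1, and the decision to read is a function of [l], hence
    independent of the increment, which is averaged over [l]. *)
Lemma osss_step L l x f g (r : (T -> bool) -> bool) :
  {subset l <= L} -> x \in L -> x \notin l -> (forall s, `|g s| <= 1) ->
  dep_on [in l] r -> (forall s b, ~~ r s -> g (upd s x b) = g s) ->
  `|mean q L (fun s => av q l f s * g s) -
    mean q L (fun s => av q (rcons l x) f s * g s)| <=
  mean q L (fun s => (r s)%:R) * mean q L (fun s => `|f s - avg q x f s|).
Proof.
move=> lL xL xl g1 lr rg; set h := av q l f.
have -> : av q (rcons l x) f = avg q x h.
  by rewrite -cats1 av_cat /= avg_av.
have hE : (fun s => h s - avg q x h s) = av q l (fun s => f s - avg q x f s).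
  have -> : (fun s => f s - avg q x f s) = (fun s => f s + -1 * avg q x f s).
    by apply/funext => s; rewrite mulN1r.
  by rewrite avD avZ -avg_av; apply/funext => s; rewrite mulN1r.
have xr : indep x r by exact: dep_on_indep lr xl.
rewrite -meanB (eq_mean _ _ (g := fun s =>
    (r s)%:R * (h s - avg q x h s) * g s +
    (~~ r s)%:R * g s * (h s - avg q x h s))); last first.
  by move=> s; case: (r s) => /=; ring.
rewrite meanD [X in _ + X](_ : _ = 0) ?addr0; last first.
  rewrite -(mean_avg q _ xL) -(mean_cst q L 0); congr mean.
  rewrite (_ : avg q x _ = fun s => (~~ r s)%:R * g s * avg q x (fun s => h s - avg q x h s) s).
    apply/funext => s; rewrite (_ : avg q x _ s = 0) ?mulr0//.
    by rewrite /avg !updK; ring.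
  apply: (@avM _ _ q [:: x] _ (fun s => (~~ r s)%:R * g s)) => y.
  rewrite inE => /eqP -> s b; rewrite xr.
  by case: (boolP (r s)) => rs /=; rewrite ?mul0r// rg.
apply: le_trans (normr_mean q01 _ _) _.
rewrite -(mean_indepM q _ lL); last first.
  by move=> s s1 ss; rewrite (lr _ _ ss).
apply: ler_mean => // s; rewrite normrM normrM ger0_norm ?ler0n//.
rewrite -[leRHS]mulr1 ler_pM ?mulr_ge0 ?ler0n//.
rewrite ler_wpM2l ?ler0n//.
rewrite -[h s - _]/((fun s => h s - avg q x h s) s) hE.
exact: normr_av.
Qed.

(* A decision tree reading the sites of [l] in order and skipping [x] unless
   [r x] holds.  The sum telescopes over [l]: averaging [f] over one more site
   changes its covariance with [g] only if that site is read. *)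
Lemma osss L l f g (r : T -> (T -> bool) -> bool) :
  uniq l -> {subset l <= L} -> (forall s, `|g s| <= 1) -> dep_on [in l] g ->
  (forall l1 x l2, l = l1 ++ x :: l2 -> dep_on [in l1] (r x) /\
     forall s b, ~~ r x s -> g (upd s x b) = g s) ->
  `|mean q L (fun s => f s * g s) - mean q L f * mean q L g| <=
  \sum_(x <- l) mean q L (fun s => (r x s)%:R) *
                mean q L (fun s => `|f s - avg q x f s|).
Proof.
move=> ul lL g1 lg lr.
have -> : mean q L f * mean q L g = mean q L (fun s => av q l f s * g s).
  rewrite mulrC -(mean_indepM q f lL lg).
  by apply: eq_mean => s; rewrite mulrC.
have: prefix l l by rewrite prefix_refl.
elim/last_ind: {1 3 4}l => [_|l1 x IH].
  by rewrite big_nil subrr normr0.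
move=> /prefixP[l2 El]; have El' : l = l1 ++ x :: l2 by rewrite El cat_rcons.
have pl1 : prefix l1 l by rewrite El' prefix_prefix.
have xl : x \in l by rewrite El' mem_cat mem_head orbT.
have [lrx rg] := lr _ _ _ El'.
rewrite -(subrKA (mean q L (fun s => av q l1 f s * g s))) big_rcons/=.
apply: le_trans (ler_normD _ _) _; apply: lerD; first exact: IH.
apply: osss_step => //.
- by move=> y yl1; apply: lL; rewrite El' mem_cat yl1.
- exact: lL.
- by move: ul; rewrite El' cat_uniq /= negb_or => /and3P[_ /andP[]].
Qed.

End osss.

(** * A Poincaré inequality with auxiliary constraints *)

Section auxiliary_poincare.
Context {R : realFieldType} {T : eqType}.
Variable q : R.
Hypothesis q01 : 0 < q < 1.
Implicit Types (s : T -> bool) (x y : T) (l L : seq T) (f g : (T -> bool) -> R).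

Let q01' : 0 <= q <= 1.
Proof. by have /andP[/ltW-> /ltW->] := q01. Qed.

Let qq : 0 < q * (1 - q).
Proof. by have /andP[h0 h1] := q01; rewrite mulr_gt0// subr_gt0. Qed.

Definition before L x := take (index x L) L.

Lemma before_cat l1 x l2 : uniq (l1 ++ x :: l2) -> before (l1 ++ x :: l2) x = l1.
Proof.
rewrite cat_uniq /= negb_or => /and3P[_ /andP[xl1 _] _].
by rewrite /before index_cat (negPf xl1) /= eqxx addn0 take_size_cat.
Qed.

(** Martingale decomposition: by [mean_avg_sqr], averaging over one more site lowers the second
    moment by [q * (1 - q)] times the squared gradient of the current average. *)
Lemma variance_telescope L l g (w : T -> R) : {subset l <= L} ->
  (forall l1 x l2, l = l1 ++ x :: l2 ->
     mean q L (fun s => grad x (av q l1 g) s ^+ 2) <= w x) ->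
  mean q L (fun s => g s ^+ 2) - mean q L (fun s => av q l g s ^+ 2) <=
  q * (1 - q) * \sum_(x <- l) w x.
Proof.
move=> lL lw; have: prefix l l by rewrite prefix_refl.
elim/last_ind: {1 3 4}l => [_|l1 x IH].
  by rewrite big_nil subrr mulr0.
move=> /prefixP[l2 El]; have El' : l = l1 ++ x :: l2 by rewrite El cat_rcons.
have pl1 : prefix l1 l by rewrite El' prefix_prefix.
have xL : x \in L by apply: lL; rewrite El' mem_cat mem_head orbT.
rewrite -(subrKA (mean q L (fun s => av q l1 g s ^+ 2))) big_rcons/= mulrDr.
apply: lerD; first exact: IH.
rewrite -cats1 av_cat /= -avg_av mean_avg_sqr// ler_wpM2l// ?(ltW qq)//.
exact: lw El'.
Qed.

Lemma grad0_sqr x f L : indep x f -> mean q L (fun s => grad x f s ^+ 2) = 0.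
Proof.
by move=> xf; rewrite -(mean_cst q L 0); apply: eq_mean => s;
  rewrite indep_gradP// expr0n.
Qed.

Variables (L : seq T) (f : (T -> bool) -> R).
Hypothesis uL : uniq L.

(** Up to the factor [q * (1 - q)], the share of the variance carried by [x] when the sites of [L]
    are averaged in order. *)
Let v x := mean q L (fun s => grad x (av q (before L x) f) s ^+ 2).

Let v_ge0 x : 0 <= v x.
Proof. by apply: mean_ge0 => // s; exact: sqr_ge0. Qed.

Let before_sub x : {subset before L x <= L}.
Proof. by move=> y; exact: mem_take. Qed.

Let notin_before x : x \in L -> x \notin before L x.
Proof.
by move=> xL; rewrite /before in_take// ltnn.
Qed.

(** The telescoping is run on [av q D f]. The sites of [D] are already averaged and contribute
    nothing, so only [x] and the earlier sites of [B] remain, each with at most its share [v] by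
    Jensen's inequality. *)
Lemma grad_av_diff (B : pred T) x : x \in L ->
  mean q L (fun s => grad x (av q [seq y <- before L x | ~~ B y] f) s ^+ 2) <=
  v x + \sum_(y <- L | B y) v y.
Proof.
move=> xL; set V := before L x; set D := [seq y <- V | ~~ B y].
have xV := notin_before xL; rewrite -/V in xV.
have DL : {subset D <= L} by move=> y; rewrite mem_filter => /andP[_ /before_sub].
have VxL : {subset rcons V x <= L}.
  by move=> y; rewrite mem_rcons inE => /predU1P[->//|/before_sub].
have LE : L = rcons V x ++ drop (index x L).+1 L.
  rewrite -[LHS](cat_take_drop (index x L).+1) (take_nth x) ?index_mem//.
  by rewrite nth_index.
pose w y := if (y == x) || B y then v y else 0.
have tele : mean q L (fun s => av q D f s ^+ 2) -
    mean q L (fun s => av q (rcons V x) (av q D f) s ^+ 2) <=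
    q * (1 - q) * \sum_(y <- rcons V x) w y.
  apply: variance_telescope => // l1 y l2 E.
  have El1 : l1 = before L y.
    move: uL; rewrite LE E -catA cat_cons => /before_cat.
    by rewrite -cat_cons catA -E -LE.
  have [yD|yD] := boolP (y \in D).
    rewrite grad0_sqr; first by rewrite /w; case: ifP.
    by apply: indep_av_out; exact: indep_av.
  have yBx : (y == x) || B y.
    have : y \in rcons V x by rewrite E mem_cat mem_head orbT.
    rewrite mem_rcons inE => /orP[->//|yV].
    by move: yD; rewrite mem_filter yV andbT /= negbK => ->; rewrite orbT.
  by rewrite /w yBx El1 av_avC grad_av// mean_av_sqr.
rewrite -(ler_pM2l qq) -mean_avg_sqr//.
apply: le_trans (_ : _ <= q * (1 - q) * \sum_(y <- rcons V x) w y) _.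
  apply: le_trans tele; rewrite lerD2l lerN2 -cats1 av_cat /=.
  by rewrite mean_av_sqr// => y /before_sub.
have wx : w x = v x by rewrite /w eqxx.
rewrite ler_wpM2l// ?(ltW qq)// big_rcons/= wx addrC lerD2l.
have VLsum : \sum_(y <- V) w y <= \sum_(y <- V | B y) v y.
  rewrite [leRHS]big_mkcond/= big_seq [leRHS]big_seq.
  by apply: ler_sum => y yV; rewrite /w; case: eqVneq yV xV => // ->->.
apply: (le_trans VLsum).
by rewrite [in leRHS]LE -cats1 -catA big_cat /= lerDl sumr_ge0.
Qed.

Variables (B : T -> pred T) (c : T -> (T -> bool) -> bool) (eps : R) (N : nat).
Hypothesis before_B : forall x, x \in L -> forall y, B x y -> y \in before L x.
Hypothesis dep_c : forall x, x \in L -> dep_on (B x) (c x).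
Hypothesis mean_c : forall x, x \in L -> mean q L (fun s => (~~ c x s)%:R) <= eps.
Hypothesis count_B : forall y, y \in L -> (count (fun x => B x y) L <= N)%N.
Hypothesis eps_small : 4 * eps * N.+1%:R <= 1.
Hypothesis eps_ge0 : 0 <= eps.

(** The gradient is split according to [c x]. Where [c x] holds, Jensen's inequality suffices. Where
    it fails, Cauchy-Schwarz over the sites of [B x] isolates the failure probability, at most
    [eps], and leaves the gradient averaged over the other earlier sites, which [grad_av_diff]
    bounds. *)
Lemma grad_av_before x : x \in L ->
  v x <= 2 * mean q L (fun s => (c x s)%:R * grad x f s ^+ 2) +
         2 * eps * (v x + \sum_(y <- L | B x y) v y).
Proof.
move=> xL; set V := before L x.
pose BV := [seq y <- V | B x y]; pose D := [seq y <- V | ~~ B x y].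
have xV := notin_before xL; rewrite -/V in xV.
have xD : x \notin D by rewrite mem_filter negb_and xV orbT.
have BVL : {subset BV <= L} by move=> y; rewrite mem_filter => /andP[_ /before_sub].
pose a := av q V (fun s => (c x s)%:R * grad x f s).
pose b := av q V (fun s => (~~ c x s)%:R * grad x f s).
have abE s : grad x (av q V f) s = a s + b s.
  rewrite grad_av// /a /b -[RHS]/((fun s => _ + _) s) -avD; congr (av _ _ _ _).
  by apply/funext => s'; case: (c x s') => /=; ring.
apply: le_trans (_ : _ <= 2 * mean q L (fun s => a s ^+ 2) +
                          2 * mean q L (fun s => b s ^+ 2)) _.
  rewrite -!meanZ -meanD; apply: ler_mean => // s; rewrite abE.
  by have := sqr_ge0 (a s - b s); rewrite sqrrB sqrrD => ?; lra.
rewrite lerD// -?mulrA ler_wpM2l//.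
  apply: le_trans (mean_av_sqr q01' _ (before_sub (x := x))) _.
  by apply: ler_mean => // s; case: (c x s); rewrite ?mul1r ?mul0r ?expr0n.
have dBV : dep_on [in BV] (fun s => (~~ c x s)%:R : R).
  move=> s s' ss'; rewrite (dep_c xL (s' := s'))// => y By; apply: ss'.
  by rewrite mem_filter By before_B.
have bE : b = av q BV (fun s => (~~ c x s)%:R * av q D (grad x f) s).
  rewrite /b -(@avM _ _ q D) => [|y yD].
    rewrite -av_cat; apply: av_eq_mem => y; rewrite mem_cat !mem_filter /=.
    by case: (B x y); rewrite /= ?orbF.
  apply: dep_on_indep dBV _.
  by move: yD; rewrite !mem_filter /= negb_and => /andP[->].
have bsq s : b s ^+ 2 <= eps * av q BV (fun s => grad x (av q D f) s ^+ 2) s.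
  rewrite bE grad_av//; apply: (le_trans (av_CauchySchwarz q01' _ _ _ _)).
  rewrite ler_wpM2r//.
    rewrite (_ : 0 = av q BV (fun=> 0) s); last by rewrite av_cst.
    by apply: ler_av => // s'; exact: sqr_ge0.
  rewrite (_ : (fun s => _) = fun s => (~~ c x s)%:R); last first.
    by apply/funext => s'; case: (c x s'); rewrite ?expr0n ?expr1n.
  rewrite av_dep_on// -(mean_supp _ dBV BVL).
  exact: mean_c.
apply: le_trans (ler_mean q01' L bsq) _.
rewrite meanZ mean_av// ler_wpM2l//.
exact: grad_av_diff.
Qed.

(** Summing [grad_av_before] over [x] bounds the total [V] of the shares by
    [2 * Dir + 2 * eps * N.+1%:R * V]; the last term is at most [V / 2] and is absorbed. *)
Theorem auxiliary_poincare :
  mean q L (fun s => f s ^+ 2) - mean q L (fun s => av q L f s ^+ 2) <=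
  4 * (q * (1 - q)) *
    \sum_(x <- L) mean q L (fun s => (c x s)%:R * grad x f s ^+ 2).
Proof.
have /le_trans : mean q L (fun s => f s ^+ 2) - mean q L (fun s => av q L f s ^+ 2) <=
    q * (1 - q) * \sum_(x <- L) v x.
  apply: variance_telescope => // l1 x l2 E; rewrite /v.
  by move: uL; rewrite E => /before_cat ->.
apply; rewrite [4 * (_ * _)]mulrC -[leRHS]mulrA ler_wpM2l ?(ltW qq)//.
set V := \sum_(x <- L) v x; set Dir := \sum_(x <- L) _.
have V0 : 0 <= V by apply: sumr_ge0.
have double : \sum_(x <- L) \sum_(y <- L | B x y) v y <= N%:R * V.
  rewrite (exchange_big_dep xpredT)//= mulr_sumr big_seq [leRHS]big_seq.
  apply: ler_sum => y yL; rewrite big_const_seq iter_addr_0 -[leLHS]mulr_natl.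
  by rewrite ler_wpM2r// ler_nat count_B.
have : V <= 2 * Dir + 2 * eps * (V + \sum_(x <- L) \sum_(y <- L | B x y) v y).
  rewrite /V /Dir mulr_sumr -big_split/= mulr_sumr -big_split/=.
  rewrite big_seq [leRHS]big_seq. apply: ler_sum => x; exact: grad_av_before.
have : 2 * eps * (V + \sum_(x <- L) \sum_(y <- L | B x y) v y) <=
       2 * eps * (N.+1%:R * V).
  by rewrite ler_wpM2l ?mulr_ge0// -natr1 mulrDl mul1r addrC lerD2r.
have := ler_wpM2r V0 eps_small; rewrite mul1r.
move: (\sum_(x <- L) _) => W h1 h2 h3.
have : 2 * eps * (N.+1%:R * V) = 4 * eps * N.+1%:R * V / 2 by field.
by move=> E; rewrite E in h2; lra.
Qed.

End auxiliary_poincare.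

(** * Filling procedures and legal paths *)

Section filling.
Context {T : eqType}.
Variables (c : (T -> bool) -> T -> bool) (nbh : T -> pred T).
Hypothesis c_homo : forall (s s' : T -> bool) x, (forall y, nbh x y -> s y -> s' y) ->
  c s x -> c s' x.
Implicit Types (s : T -> bool) (x y : T) (l : seq T).

Lemma c_dep x : dep_on (nbh x) (c^~ x).
Proof.
move=> s s' ss'; apply/idP/idP; apply: c_homo => y xy; first by rewrite ss'.
by rewrite -ss'.
Qed.

Lemma c_indep x y : ~~ nbh x y -> indep y (c^~ x).
Proof. exact: dep_on_indep (@c_dep x). Qed.

(** One sweep through [l], with everything outside [l] unfilled. In an [ordered] list the sites of
    [l] that [x] can see come before [x], so a single sweep already reaches the closure. *)
Definition fill l s : T -> bool :=
  foldl (fun a x => upd a x (s x || c a x)) (fun=> false) l.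

Definition ordered l := uniq l /\
  forall l1 x l2, l = l1 ++ x :: l2 -> forall y, y \in x :: l2 -> ~~ nbh x y.

Lemma fill_rcons l x s :
  fill (rcons l x) s = upd (fill l s) x (s x || c (fill l s) x).
Proof. by rewrite /fill -cats1 foldl_cat. Qed.

Lemma fill_out l s x : x \notin l -> fill l s x = false.
Proof.
elim/last_ind: l => // l y IH; rewrite mem_rcons inE negb_or => /andP[xy xl].
by rewrite fill_rcons updE (negPf xy) IH.
Qed.

Lemma fill_dep l : dep_on [in l] (fill l).
Proof.
elim/last_ind: l => // l y IH s s' ss'; rewrite !fill_rcons (IH _ s').
  by rewrite ss'// mem_rcons mem_head.
by move=> x xl; apply: ss'; rewrite /= mem_rcons inE xl orbT.
Qed.

Lemma fill_cat_out l1 l2 s x : x \notin l2 -> fill (l1 ++ l2) s x = fill l1 s x.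
Proof.
elim/last_ind: l2 => [|l2 y IH]; first by rewrite cats0.
rewrite mem_rcons inE negb_or => /andP[xy xl].
by rewrite -rcons_cat fill_rcons updE (negPf xy) IH.
Qed.

Lemma c_fill_prefix l l1 x l2 s : ordered l -> l = l1 ++ x :: l2 ->
  c (fill l s) x = c (fill l1 s) x.
Proof.
move=> [_ ol] /[dup]E /ol xl2; rewrite E; apply: c_dep => y xy.
by rewrite fill_cat_out//; apply: contraL xy; exact: xl2.
Qed.

Lemma fill_fix l s x : ordered l -> x \in l ->
  fill l s x = s x || c (fill l s) x.
Proof.
move=> ol /splitPr E; case: E ol => l1 l2 ol.
rewrite (c_fill_prefix s ol erefl) -cat_rcons fill_cat_out; last first.
  by have [] := ol; rewrite cat_uniq /= => /and3P[_ _ /andP[]].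
by rewrite fill_rcons upd_same.
Qed.

(** With [fill_fix] this makes [fill l s] the least configuration closed under the rules on [l]; the
    comparisons below follow by choosing [F]. *)
Lemma fill_super l s (F : T -> bool) :
  (forall x, x \in l -> s x || c F x -> F x) -> forall y, fill l s y -> F y.
Proof.
elim/last_ind: l => // l x IH lF y; rewrite fill_rcons updE.
have lF' z : fill l s z -> F z.
  by apply: IH => t tl; apply: lF; rewrite mem_rcons inE tl orbT.
case: eqP => [->|_]; last exact: lF'.
move=> sc; apply: lF; first by rewrite mem_rcons mem_head.
case/orP: sc => [->//|]; rewrite orbC => cx.
by rewrite (c_homo _ cx)// => z _; exact: lF'.
Qed.

Lemma fill_sub l l' s y : ordered l -> {subset l' <= l} ->
  fill l' s y -> fill l s y.
Proof.
by move=> ol ll'; apply: fill_super => x /ll' xl; rewrite -fill_fix.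
Qed.

Lemma fill_homo l s s' y : ordered l -> (forall x, s x -> s' x) ->
  fill l s y -> fill l s' y.
Proof.
move=> ol ss'; apply: fill_super => x xl; rewrite (fill_fix s')//.
by case/orP => [/ss' ->//|->]; rewrite orbT.
Qed.

Lemma c_fill_dep l l1 x l2 : ordered l -> l = l1 ++ x :: l2 ->
  dep_on [in l1] (fun s => c (fill l s) x).
Proof.
by move=> ol E s s' ss'; rewrite !(c_fill_prefix _ ol E) (fill_dep ss').
Qed.

Lemma c_fill_indep l x : ordered l -> x \in l ->
  indep x (fun s => c (fill l s) x).
Proof.
move=> ol /splitPr E; case: E ol => l1 l2 ol.
apply: dep_on_indep (c_fill_dep ol erefl) _ => /=.
by have [] := ol; rewrite cat_uniq /= negb_or => /and3P[_ /andP[]].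
Qed.

(** Where its constraint is met, [x] ends up filled whatever its initial state. This serves twice:
    the exploration may skip [x], and allowed updates preserve the event that the origin stays
    unfilled. *)
Lemma fill_upd l s x b : ordered l -> x \in l ->
  c (fill l s) x -> fill l (upd s x b) = fill l s.
Proof.
move=> ol xl cx.
have cx' : c (fill l (upd s x b)) x by rewrite (c_fill_indep ol xl).
apply/funext => y; apply/idP/idP; apply: fill_super => z zl.
  have [-> _|zx] := eqVneq z x; first by rewrite fill_fix// cx orbT.
  by rewrite updE (negPf zx) -fill_fix.
have [-> _|zx] := eqVneq z x; first by rewrite fill_fix// cx' orbT.
by rewrite [in X in _ -> X]fill_fix// updE (negPf zx).
Qed.

Lemma fill_upd_restrict l s x b : ordered l -> x \in l ->
  c (fun y => s y && (y \in l)) x -> fill l (upd s x b) = fill l s.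
Proof.
move=> ol xl cx; apply: fill_upd => //; apply: c_homo cx => y _ /andP[sy yl].
by rewrite fill_fix// sy.
Qed.

End filling.

Section path_argument.
Context {R : realFieldType} {T : eqType}.
Variables (c : (T -> bool) -> T -> bool) (nbh : T -> pred T).
Hypothesis c_homo : forall (s s' : T -> bool) x,
  (forall y, nbh x y -> s y -> s' y) -> c s x -> c s' x.
Variable q : R.
Hypothesis q01 : 0 < q < 1.
Implicit Types (s : T -> bool) (x y : T) (l L : seq T) (f : (T -> bool) -> R).

Let q01' : 0 <= q <= 1.
Proof. by have /andP[/ltW-> /ltW->] := q01. Qed.

Let q_gt0 : 0 < q. Proof. by have /andP[] := q01. Qed.
Let p_gt0 : 0 < 1 - q. Proof. by have /andP[_] := q01; rewrite subr_gt0. Qed.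

Definition legal_step y s : T -> bool := upd s y (s y || c s y).

Definition legal_path l s := foldl (fun a y => legal_step y a) s l.

Lemma fill_legal_path l s y : fill c l s y -> legal_path l s y.
Proof.
elim/last_ind: l y => // l x IH y.
rewrite fill_rcons /legal_path -cats1 foldl_cat /= -/(legal_path l s).
rewrite /legal_step !updE; case: eqP => [_|_]; last exact: IH.
case/orP => [sx|cx]; apply/orP; [left|right]; last first.
  by apply: c_homo cx => z _; exact: IH.
have : forall a : T -> bool, a x -> legal_path l a x.
  elim: l {IH} => //= z l IH a ax; apply: IH.
  by rewrite /legal_step updE; case: eqP ax => // <- ->.
by apply.
Qed.

Lemma legal_step_sqr f y s :
  (f s - f (legal_step y s)) ^+ 2 <= (c s y)%:R * grad y f s ^+ 2.
Proof.
rewrite /legal_step; case: (c s y) => /=; last first.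
  by rewrite orbF upd_id subrr expr0n mul0r.
rewrite orbT mul1r /grad -{1}(upd_id s y); case: (s y).
  by rewrite subrr expr0n sqr_ge0.
by rewrite -sqrrN opprB.
Qed.

Lemma mean_legal_step L y f : y \in L -> (forall s, 0 <= f s) ->
  mean q L (fun s => f (legal_step y s)) <= (1 + q^-1) * mean q L f.
Proof.
move=> yL f0; apply: le_trans (_ : _ <= mean q L f + mean q L (fun s => f (upd s y true))) _.
  rewrite -meanD; apply: ler_mean => // s; rewrite /legal_step.
  case: (c s y); first by rewrite orbT lerDr.
  by rewrite orbF upd_id lerDl.
rewrite mulrDl mul1r lerD2l -(ler_pM2l q_gt0) mulrA divff ?gt_eqF// mul1r.
exact: mean_upd_true.
Qed.

(** The [3] comes from the square of a sum of three terms. The bracket dominates both the cost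
    [1 + q^-1] of the change of measure in a legal step and the cost [q^-1 + (1 - q)^-1] of
    prescribing the state of one site. *)
Definition path_cst : R := 3 * (1 + q^-1 + (1 - q)^-1).

Let cst_ge1 : 1 <= path_cst.
Proof.
have h1 : 0 <= q^-1 by rewrite invr_ge0 ltW.
have h2 : 0 <= (1 - q)^-1 by rewrite invr_ge0 ltW.
by rewrite /path_cst; lra.
Qed.

(** Induction along the path. The gradients at [x] before and after the first step differ by two
    increments of [f] across a legal move at [y], one with [x] filled and one with [x] unfilled,
    each controlled by the Dirichlet term of [y]. *)
Lemma path_energy L l x f : x \in L -> {subset l <= L} -> x \notin l ->
  (forall y, y \in l -> ~~ nbh y x) ->
  mean q L (fun s => (c (legal_path l s) x)%:R * grad x f s ^+ 2) <=
  path_cst ^+ size l *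
    (mean q L (fun s => (c s x)%:R * grad x f s ^+ 2) +
     \sum_(y <- l) mean q L (fun s => (c s y)%:R * grad y f s ^+ 2)).
Proof.
move=> xL; elim: l => [|y l IH] lL xl lx.
  by rewrite big_nil addr0 expr0 mul1r.
have yL : y \in L by apply: lL; rewrite mem_head.
have [xy xl'] : x != y /\ x \notin l by move: xl; rewrite inE negb_or => /andP[].
have yx : ~~ nbh y x by apply: lx; rewrite mem_head.
have {}IH := IH (fun z zl => lL z (@mem_behead _ (y :: l) z zl)) xl'
                (fun z zl => lx z (@mem_behead _ (y :: l) z zl)).
pose G s := (c (legal_path l s) x)%:R * grad x f s ^+ 2.
pose H s := (c s y)%:R * grad y f s ^+ 2.
have G0 s : 0 <= G s by rewrite mulr_ge0 ?ler0n ?sqr_ge0.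
have H0 s : 0 <= H s by rewrite mulr_ge0 ?ler0n ?sqr_ge0.
(* The constraint at [y] does not look at [x], so flipping [x] commutes with the move. *)
have stepC s b : legal_step y (upd s x b) = upd (legal_step y s) x b.
  rewrite /legal_step (c_indep c_homo yx) updE eq_sym (negPf xy).
  exact: updC.
have pt s : (c (legal_path (y :: l) s) x)%:R * grad x f s ^+ 2 <=
    3 * G (legal_step y s) + (3 * H (upd s x true) + 3 * H (upd s x false)).
  rewrite /G /=; set b := c _ x; set s' := legal_step y s.
  have h1 := legal_step_sqr f y (upd s x true).
  have h2 := legal_step_sqr f y (upd s x false).
  rewrite !stepC -/(H _) in h1 h2.
  rewrite -/s' in h1 h2.
  case: b => /=; rewrite ?mul0r ?mulr0 ?mul1r ?add0r; last first.
    by rewrite addr_ge0// mulr_ge0.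
  apply: le_trans (_ : _ <= 3 * grad x f s' ^+ 2 +
     (3 * (f (upd s x true) - f (upd s' x true)) ^+ 2 +
      3 * (f (upd s x false) - f (upd s' x false)) ^+ 2)) _; last first.
    by rewrite lerD2l lerD// ler_wpM2l.
  rewrite /grad; set a1 := f _; set a2 := f _; set a3 := f _; set a4 := f _.
  have e1 := sqr_ge0 ((a3 - a4) - (a1 - a3)).
  have e2 := sqr_ge0 ((a3 - a4) + (a2 - a4)).
  have e3 := sqr_ge0 ((a1 - a3) + (a2 - a4)).
  rewrite -subr_ge0; suff <- : ((a3 - a4) - (a1 - a3)) ^+ 2 +
    ((a3 - a4) + (a2 - a4)) ^+ 2 + ((a1 - a3) + (a2 - a4)) ^+ 2 =
    3 * (a3 - a4) ^+ 2 + (3 * (a1 - a3) ^+ 2 + 3 * (a2 - a4) ^+ 2) - (a1 - a2) ^+ 2.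
    by rewrite !addr_ge0.
  by ring.
apply: le_trans (ler_mean q01' L pt) _; rewrite !meanD !meanZ big_cons -/H.
have hG := mean_legal_step yL G0.
have hT : mean q L (fun s => H (upd s x true)) <= q^-1 * mean q L H.
  by rewrite -(ler_pM2l q_gt0) mulrA divff ?gt_eqF// mul1r; exact: mean_upd_true.
have hF : mean q L (fun s => H (upd s x false)) <= (1 - q)^-1 * mean q L H.
  by rewrite -(ler_pM2l p_gt0) mulrA divff ?gt_eqF// mul1r; exact: mean_upd_false.
have iq : 0 <= q^-1 by rewrite invr_ge0 ltW.
have ip : 0 <= (1 - q)^-1 by rewrite invr_ge0 ltW.
have mH0 : 0 <= mean q L H by exact: mean_ge0.
set A := mean q L (fun s => (c s x)%:R * grad x f s ^+ 2).
set S := \sum_(z <- l) _; rewrite -/A -/S -/G in IH.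
set K := path_cst ^+ size l in IH *.
have K1 : 1 <= K by exact: exprn_ege1.
have AS0 : 0 <= A + S.
  rewrite addr_ge0 ?mean_ge0// ?sumr_ge0// => *; rewrite ?mean_ge0// => *;
  by rewrite mulr_ge0 ?ler0n ?sqr_ge0.
rewrite /= exprS -/K [A + _]addrCA [leRHS]mulrDr [leLHS]addrC; apply: lerD.
  apply: le_trans (_ : _ <= path_cst * mean q L H) _; last first.
    by rewrite ler_wpM2r// ler_peMr// (le_trans ler01).
  apply: le_trans (_ : _ <= 3 * (q^-1 * mean q L H) + 3 * ((1 - q)^-1 * mean q L H)) _.
    by rewrite lerD// ler_wpM2l.
  by rewrite /path_cst; lra.
apply: le_trans (_ : _ <= 3 * ((1 + q^-1) * (K * (A + S)))) _.
  rewrite ler_wpM2l//; apply: (le_trans hG).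
  by rewrite ler_wpM2l// addr_ge0.
rewrite !mulrA ler_wpM2r// ler_wpM2r ?(le_trans ler01)//.
by rewrite /path_cst; lra.
Qed.

End path_argument.

(** * Russo's formula and the differential inequality *)

Section russo.
Context {R : realType} {T : eqType}.

Lemma is_derive_av (l : seq T) (f : (T -> bool) -> R) (q : R) s : uniq l ->
  is_derive q 1 (fun r => av r l f s) (\sum_(x <- l) av q l (grad x f) s).
Proof.
elim: l s => [|y l IH] s /= => [_|/andP[yl ul]].
  by rewrite big_nil; exact: is_derive_cst.
have D b := IH (upd s y b) ul.
have -> : (fun r => avg r y (av r l f) s) =
  id * (fun r => av r l f (upd s y true)) +
  (cst 1 - id) * (fun r => av r l f (upd s y false)) by apply/funext.
have Did : is_derive q 1 (id : R -> R) 1 by exact: is_derive_id.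
have Dco : is_derive q 1 (cst 1 - id : R -> R) (0 - 1).
  by apply: is_deriveB; exact: is_derive_cst.
have := is_deriveD (is_deriveM Did (D true)) (is_deriveM Dco (D false)).
move=> /is_derive_eq; apply.
rewrite big_cons (_ : avg q y (av q l (grad y f)) s = grad y (av q l f) s); last first.
  by rewrite avg_av avg_indep ?grad_av//; exact: indep_grad.
have -> : \sum_(x <- l) avg q y (av q l (grad x f)) s =
    q * \sum_(x <- l) av q l (grad x f) (upd s y true) +
    (1 - q) * \sum_(x <- l) av q l (grad x f) (upd s y false).
  by rewrite !mulr_sumr -big_split.
rewrite /grad /GRing.scale /= (_ : (cst 1 - id : R -> R) q = 1 - q)//; ring.
Qed.

Lemma is_derive_mean (l : seq T) (f : (T -> bool) -> R) (q : R) : uniq l ->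
  is_derive q 1 (fun r => mean r l f) (\sum_(x <- l) mean q l (grad x f)).
Proof. exact: is_derive_av. Qed.

End russo.

(** * Superpolynomial decay from the differential inequality *)

Section sharpness.
Context {R : realType}.

Lemma derive_le_increment (f df : R -> R) (a b c : R) : a <= b ->
  (forall r : R, is_derive r 1 f (df r)) ->
  (forall r, a < r < b -> df r <= c) -> f b - f a <= c * (b - a).
Proof.
rewrite le_eqVlt => /predU1P[->|ab] fdf dfc; first by rewrite !subrr mulr0.
have [|x] := @MVT R f df a b ab (fun r _ => fdf r).
  apply/continuous_subspaceT => r.
  by apply/differentiable_continuous/derivable1_diffP; have [] := fdf r.
rewrite in_itv/= => xab ->; rewrite ler_wpM2r ?subr_ge0 ?(ltW ab)//.
exact: dfc.
Qed.

Lemma harmonic_le (n : nat) :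
  \sum_(i < n.+1) (i.+1%:R : R)^-1 <= 1 + ln n.+1%:R.
Proof.
elim: n => [|n IH]; first by rewrite big_ord1 invr1 ln1 addr0.
rewrite big_ord_recr/=; apply: le_trans (lerD IH (lexx _)) _.
rewrite -addrA lerD2l -lerBrDl -ln_div ?posrE ?ltr0n//.
rewrite -[leLHS]opprK -[leRHS]opprK lerN2 -lnV ?posrE ?divr_gt0 ?ltr0n//.
rewrite invf_div.
rewrite (_ : _ / _ = 1 + (- (n.+2%:R : R)^-1)); last first.
  rewrite -(natr1 n.+1); have : 0 < (n.+1%:R : R) by rewrite ltr0n.
  by move: n.+1%:R => x x0; field; apply: lt0r_neq0; lra.
apply: le_ln1Dx; rewrite ltrN2 invf_lt1 ?ltr0n// ltr1n.
by [].
Qed.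

(** The bound [1 + t <= expR t] at [t = y / k.+1%:R], raised to the power [k.+1]; it converts a
    stretched exponential into polynomial decay of any order. *)
Lemma expRN_le (y : R) (k : nat) : 0 < y ->
  expR (- y) <= (k.+1%:R / y) ^+ k.+1.
Proof.
move=> y0; rewrite expRN -[leRHS]invrK lef_pV2 ?posrE ?invr_gt0 ?exprn_gt0 ?divr_gt0 ?expR_gt0 ?ltr0n//.
have -> : expR y = expR (y / k.+1%:R) ^+ k.+1.
  by rewrite -expRM_natl mulrC divfK ?pnatr_eq0.
rewrite -exprVn invf_div lerXn2r ?nnegrE ?divr_ge0 ?expR_ge0 ?ler0n ?(ltW y0)//.
by apply: le_trans (expR_ge1Dx _); rewrite lerDr.
Qed.

Variables (th dth : nat -> R -> R).
Let S n r := \sum_(k < n) th k r.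

Hypothesis th_derive : forall n (r : R), is_derive r 1 (th n) (dth n r).
Hypothesis dth_le0 : forall n (r : R), 0 < r < 1 -> dth n r <= 0.
Hypothesis th_ge0 : forall n (r : R), 0 <= r <= 1 -> 0 <= th n r.
Hypothesis th_le1 : forall n (r : R), 0 <= r <= 1 -> th n r <= 1.
Hypothesis th0_gt0 : forall r : R, r < 1 -> 0 < th 0 r.
Hypothesis th_diff : forall n (r : R), 0 < r < 1 ->
  n%:R * th n r <= 2 * S n r * - dth n r.

Let th_anti n (a b : R) : 0 <= a -> a <= b -> b <= 1 -> th n b <= th n a.
Proof.
move=> a0 ab b1; have := @derive_le_increment _ _ a b 0 ab (th_derive n).
rewrite mul0r subr_le0; apply=> r /andP[ar rb].
by apply: dth_le0; rewrite (le_lt_trans a0 ar) (lt_le_trans rb b1).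
Qed.

Let S_anti n (a b : R) : 0 <= a -> a <= b -> b <= 1 -> S n b <= S n a.
Proof. by move=> a0 ab b1; apply: ler_sum => i _; exact: th_anti. Qed.

Let S_gt0 n (r : R) : 0 <= r < 1 -> 0 < S n.+1 r.
Proof.
move=> /andP[r0 r1]; rewrite /S big_ord_recl ltr_pwDl ?th0_gt0//.
by apply: sumr_ge0 => i _; rewrite th_ge0// r0 ltW.
Qed.

(* Along [r], the logarithmic average of [th] decreases at least as fast as
   [ln S] grows along [n]. *)
Let ln_S_le n (a b : R) : 0 <= a -> a < b -> b < 1 ->
  (b - a) * ln (S n.+1 b) <= 2 * \sum_(i < n) th i.+1 a / i.+1%:R.
Proof.
move=> a0 ab b1.
pose U (r : R) := \sum_(i < n) th i.+1 r / i.+1%:R.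
pose dU (r : R) := \sum_(i < n) dth i.+1 r / i.+1%:R.
have UdU (r : R) : is_derive r 1 U (dU r).
  have -> : U = \sum_(i < n) ((i.+1%:R)^-1 \*: th i.+1).
    by apply/funext => x; rewrite fct_sumE; apply: eq_bigr => i _; rewrite mulrC.
  have -> : dU r = \sum_(i < n) ((i.+1%:R)^-1 *: dth i.+1 r).
    by apply: eq_bigr => i _; rewrite mulrC.
  by apply: is_derive_sum => i; exact: is_deriveZ.
have dUle (r : R) : a < r < b -> dU r <= - (2^-1 * ln (S n.+1 b)).
  move=> /andP[ar rb]; have r01 : 0 < r < 1 by rewrite (le_lt_trans a0 ar) (lt_trans rb b1).
  have [r0 r1] := andP r01.
  have S0 m : 0 < S m.+1 r by apply: S_gt0; rewrite (ltW r0).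
  rewrite lerNr -sumrN.
  apply: le_trans (_ : _ <= 2^-1 * ln (S n.+1 r)) _.
    rewrite ler_wpM2l// ler_ln ?posrE ?S0 ?S_gt0//; last by rewrite (le_trans a0 (ltW ab)).
    by apply: S_anti; rewrite ltW.
  (* Telescoping [ln S]: by [ln (1 + u) <= u] each increment is at most [th i.+1 r / S i.+1 r]. The
     first term [ln (S 1 r)] is then dropped, being nonpositive because [th 0 r <= 1]. *)
  apply: le_trans (_ : _ <= 2^-1 * (ln (S 1 r) + \sum_(i < n) th i.+1 r / S i.+1 r)) _.
    rewrite ler_wpM2l//; elim: n {UdU U dU} => [|m IHm]; first by rewrite big_ord0 addr0.
    rewrite big_ord_recr/= addrA -lerBlDr; apply: le_trans IHm.
    rewrite lerBlDr -lerBlDl -ln_div ?posrE//.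
    rewrite [X in ln (X / _)](_ : _ = S m.+1 r + th m.+1 r); last first.
      by rewrite /S big_ord_recr.
    rewrite mulrDl divff ?gt_eqF// le_ln1Dx// (lt_le_trans (ltrN10 _))// divr_ge0 ?(ltW (S0 _))//.
    by rewrite th_ge0// (ltW r0) ltW.
  apply: le_trans (_ : _ <= 2^-1 * \sum_(i < n) th i.+1 r / S i.+1 r) _.
    rewrite ler_wpM2l// gerDr ln_le0// /S big_ord1 th_le1//.
    by rewrite (ltW r0) ltW.
  rewrite mulr_sumr; apply: ler_sum => i _.
  rewrite -mulNr ler_pdivlMr ?ltr0n// mulrA mulrAC ler_pdivrMr//.
  by have := th_diff i.+1 r01; set x := th _ _; lra.
have H := derive_le_increment (ltW ab) UdU dUle.
have : 0 <= U b.
  apply: sumr_ge0 => i _; rewrite divr_ge0 ?ler0n// th_ge0// (ltW b1) andbT.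
  by rewrite (le_trans a0 (ltW ab)).
rewrite -/(U a); move: H; set L := ln _; lra.
Qed.

(* [ln_S_le] turns the vanishing of [th] at [q0] into [S n = O(sqrt n)] slightly
   above, and [th_diff] then integrates to a stretched exponential bound. *)
Lemma superpolynomial_decay q0 q (m : nat) (e : R) : 0 <= q0 -> q0 < q -> q < 1 ->
  (forall e : R, 0 < e -> exists n0, forall n, (n0 <= n)%N -> th n q0 <= e) ->
  0 < e -> exists2 n, (0 < n)%N & n%:R ^+ m * th n q <= e.
Proof.
move=> q00 q0q q1 th_cvg e0.
(* The interval from [q0] to [b] serves to bound [S] at [b], the one from [b] to [q] to integrate
   [th_diff] with that bound. *)
pose b := (q0 + q) / 2; pose dl := (q - q0) / 2.
have dl0 : 0 < dl by rewrite /dl; lra.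
have dl40 : 0 <= dl / 4 by lra.
have q0b : q0 < b by rewrite /b; lra.
have bq : b < q by rewrite /b; lra.
have b0 : 0 < b := le_lt_trans q00 q0b.
have b1 : b < 1 := lt_trans bq q1.
(* With [dl / 4], [ln_S_le] yields [2 * ln (S n.+2 b) <= ln n.+1%:R + O(1)], so [S] grows at most
   like a square root; [C] below collects the constant. *)
have [n0 n0P] : exists n0, forall n, (n0 <= n)%N -> th n q0 <= dl / 4.
  by apply: th_cvg; rewrite divr_gt0.
have q001 : 0 <= q0 <= 1 by rewrite q00 ltW// (lt_trans q0q).
have U_le n : \sum_(i < n.+1) th i.+1 q0 / i.+1%:R <=
    n0%:R + dl / 4 * (1 + ln n.+1%:R).
  have hsum : \sum_(i < n.+1) th i.+1 q0 / i.+1%:R <=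
      \sum_(i < n.+1) ((i < n0)%N%:R + dl / 4 * i.+1%:R^-1).
    apply: ler_sum => i _; case: ltnP => n0i.
      rewrite -[leLHS]addr0 lerD//; last by rewrite mulr_ge0// invr_ge0.
      by rewrite ler_pdivrMr ?ltr0n// mul1r (le_trans (th_le1 _ _))// ler1n.
    by rewrite add0r ler_wpM2r ?invr_ge0 ?ler0n// n0P// ltnW.
  apply: (le_trans hsum); rewrite big_split/= -mulr_sumr lerD//; last first.
    by rewrite ler_wpM2l// harmonic_le.
  rewrite -natr_sum ler_nat -(big_mkord xpredT (fun i => nat_of_bool (i < n0)%N)).
  rewrite -big_mkcond/= sum1_count -size_filter.
  have := @uniq_leq_size _ [seq i <- index_iota 0 n.+1 | (i < n0)%N] (iota 0 n0).
  rewrite size_iota; apply; first by rewrite filter_uniq ?iota_uniq.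
  by move=> i; rewrite mem_filter mem_iota => /andP[].
pose C := expR (4 * n0%:R / dl + 1).
have S2 n : S n.+2 b ^+ 2 <= C * n.+1%:R.
  have Sn0 : 0 < S n.+2 b by apply: S_gt0; rewrite (ltW b0).
  rewrite -ler_ln ?posrE ?exprn_gt0 ?mulr_gt0 ?expR_gt0 ?ltr0n//.
  rewrite lnXn// lnM ?posrE ?expR_gt0 ?ltr0n// expRK.
  have := ln_S_le n.+1 q00 q0b b1; rewrite (_ : b - q0 = dl); last by rewrite /b /dl; field.
  move=> h; have := U_le n; move: h.
  set U := \sum_(i < _) _; set L := ln (S _ _); set l := ln _ => h1 h2.
  rewrite -(ler_pM2l dl0) mulr2n.
  rewrite [leRHS](_ : _ = 4 * n0%:R + dl + dl * l); last by field; rewrite gt_eqF.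
  by lra.
have th_exp n : th n.+2 q <= expR (- (dl * n.+2%:R / (2 * S n.+2 b))).
  have Sn0 : 0 < S n.+2 b by apply: S_gt0; rewrite (ltW b0).
  pose k := n.+2%:R / (2 * S n.+2 b).
  have k0 : 0 <= k by rewrite divr_ge0 ?ler0n// mulr_ge0// ltW.
  (* Integrating factor: since [S n.+2 r <= S n.+2 b] for [r] above [b], [th_diff] gives
     [dth n.+2 r <= - k * th n.+2 r], and [G] is nonincreasing. *)
  pose G := (th n.+2) * (expR \o (k \*: id)) : R -> R.
  pose dG r := th n.+2 r * (expR (k * r) * k) + expR (k * r) * dth n.+2 r.
  have GdG (r : R) : is_derive r 1 G (dG r).
    have De : is_derive r 1 (expR \o (k \*: id)) (expR (k * r) * (k * 1)).
      apply: is_derive1_comp; apply: is_deriveZ.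
    by have := is_deriveM (th_derive n.+2 r) De; rewrite mulr1.
  have dG0 (r : R) : b < r < q -> dG r <= 0.
    move=> /andP[br rq].
    have r0 : 0 < r := lt_trans b0 br.
    have r1 : r < 1 := lt_trans rq q1.
    have r01 : 0 < r < 1 by rewrite r0.
    rewrite /dG mulrCA -mulrDr pmulr_rle0 ?expR_gt0//.
    have Sr0 : 0 < S n.+2 r by apply: S_gt0; rewrite (ltW r0).
    have h := th_diff n.+2 r01.
    have : 2 * S n.+2 r * - dth n.+2 r <= 2 * S n.+2 b * - dth n.+2 r.
      rewrite ler_wpM2r// ?oppr_ge0 ?dth_le0// ler_wpM2l//.
      by apply: S_anti; rewrite ltW.
    move=> /(le_trans h); rewrite -ler_pdivrMl ?mulr_gt0// => h'.
    rewrite -(opprK (dth _ _)) subr_le0; apply: le_trans h'.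
    suff -> : th n.+2 r * k = (2 * S n.+2 b)^-1 * (n.+2%:R * th n.+2 r) by [].
    by rewrite /k; ring.
  have := derive_le_increment (ltW bq) GdG dG0.
  rewrite mul0r subr_le0 /G /= => h.
  have hq : th n.+2 q * expR (k * q) <= expR (k * b).
    apply: (le_trans h); rewrite -[leRHS]mul1r ler_wpM2r ?expR_ge0//.
    by apply: th_le1; rewrite (ltW b0) ltW.
  move: hq; rewrite -ler_pdivlMr ?expR_gt0// -expRB => /le_trans; apply.
  rewrite -mulrBr ler_expR le_eqVlt; apply/orP; left; apply/eqP.
  by rewrite /k /b /dl; field; rewrite gt_eqF.
(* As [S] squared is [O(n)], the power [K] leaves decay of order [m.+1], one more than [n ^ m]
   consumes. *)
pose K := m.+1.*2.
pose Cst := ((K%:R * 2 / dl) ^+ 2 * C) ^+ m.+1.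
have Cst0 : 0 <= Cst.
  by rewrite exprn_ge0// mulr_ge0 ?sqr_ge0// expR_ge0.
have final n : n.+2%:R ^+ m * th n.+2 q <= Cst / n.+2%:R.
  have Sn0 : 0 < S n.+2 b by apply: S_gt0; rewrite (ltW b0).
  have n20 : 0 < n.+2%:R :> R by rewrite ltr0n.
  have h1 : th n.+2 q <= (K%:R / (dl * n.+2%:R / (2 * S n.+2 b))) ^+ K.
    apply: (le_trans (th_exp n)); have := @expRN_le (dl * n.+2%:R / (2 * S n.+2 b)) K.-1.
    rewrite prednK; last by rewrite /K doubleS.
    by apply; rewrite divr_gt0//; exact: mulr_gt0.
  rewrite ler_pdivlMr// mulrAC -exprSr.
  apply: le_trans (ler_wpM2l (exprn_ge0 _ (ltW n20)) h1) _.
  have base : n.+2%:R * (K%:R / (dl * n.+2%:R / (2 * S n.+2 b))) ^+ 2 <=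
      (K%:R * 2 / dl) ^+ 2 * C.
    rewrite [leLHS](_ : _ = (K%:R * 2 / dl) ^+ 2 * (S n.+2 b ^+ 2 / n.+2%:R)); last first.
      by field; rewrite !gt_eqF.
    rewrite ler_wpM2l ?sqr_ge0// ler_pdivrMr//; apply: (le_trans (S2 n)).
    by rewrite ler_wpM2l ?expR_ge0// ler_nat.
  have KE (x : R) : x ^+ K = (x ^+ 2) ^+ m.+1 by rewrite -exprM mul2n.
  rewrite KE -exprMn /Cst.
  apply: lerXn2r => //; rewrite nnegrE.
    by apply: mulr_ge0; [exact: ltW|exact: sqr_ge0].
  by apply: mulr_ge0; [exact: sqr_ge0|exact: expR_ge0].
have [n nP] : exists n : nat, Cst / e < n%:R.
  by exists (Num.trunc (Cst / e)).+1; exact: truncnS_gt.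
exists n.+2 => //; apply: (le_trans (final n)); rewrite ler_pdivrMr ?ltr0n// mulrC.
rewrite -ler_pdivrMr//; apply: (le_trans (ltW nP)); rewrite ler_nat.
by rewrite (leq_trans (leqnSn _))// leqnSn.
Qed.

End sharpness.

(** * Cones of influence *)

Section integer_direction.
Context {R : realType} {d : nat}.
Local Notation site := 'rV[int]_d.

(** Only finitely many strict inequalities have to survive, so a large multiple of [- u] can be
    rounded coordinatewise: the error in the scalar product is at most the sum [B x] of the absolute
    coordinates. *)
Lemma integer_direction (N : seq site) (u : 'rV[R]_d) :
  (forall x, x \in N -> \sum_(i < d) (x 0 i)%:~R * u 0 i < 0) ->
  exists v : 'rV[int]_d, forall x, x \in N -> 0 < \sum_(i < d) x 0 i * v 0 i.
Proof.
move=> Nu.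
pose del (x : site) : R := - \sum_(i < d) (x 0 i)%:~R * u 0 i.
pose B (x : site) : R := \sum_(i < d) `|(x 0 i)%:~R|.
pose M := (\sum_(x <- N) (Num.trunc (B x / del x)).+1)%N.
exists (\row_i - Num.floor (M%:R * u 0 i)) => x xN.
have del0 : 0 < del x by rewrite oppr_gt0 Nu.
have MB : B x < M%:R * del x.
  rewrite -ltr_pdivrMr//; apply: lt_le_trans (truncnS_gt _) _.
  by rewrite ler_nat /M (big_rem x xN) leq_addr.
rewrite -(ltr0z R) rmorph_sum/=.
apply: lt_le_trans (_ : _ < M%:R * del x - B x) _; first by rewrite subr_gt0.
rewrite /del /B mulrN -opprD lerNl -sumrN mulr_sumr -big_split/=.
apply: ler_sum => i _; rewrite mxE rmorphM rmorphN/= mulrN opprK.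
set a : R := (x 0 i)%:~R; set w := M%:R * u 0 i.
rewrite mulrCA -/w -lerBlDl -mulrBr.
have fl : `|(Num.floor w)%:~R - w| <= 1.
  have := floor_itv w; rewrite distrC => /andP[h1 h2].
  rewrite ger0_norm ?subr_ge0// lerBlDl; apply: ltW.
  by move: h2; rewrite intrD.
by apply: le_trans (ler_norm _) _; rewrite normrM ler_piMr.
Qed.

End integer_direction.

Section cone.
Context {d : nat}.
Local Notation site := 'rV[int]_d.
Variables (XX : {fset {fset site}}) (v : site).

Definition nbrs : seq site := flatten [seq enum_fset X | X : {fset site} <- enum_fset XX].

Lemma nbrsP (X : {fset site}) y : X \in XX -> y \in X -> y \in nbrs.
Proof. by move=> XXX yX; apply/flatten_mapP; exists X. Qed.

Lemma nbrs_inv y : y \in nbrs -> exists2 X : {fset site}, X \in XX & y \in X.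
Proof. by move/flatten_mapP => [X]; exists X. Qed.

Definition nbh (x y : site) : bool := y - x \in nbrs.

Lemma constraint_homo (s s' : site -> bool) x :
  (forall y, nbh x y -> s y -> s' y) -> constraint XX s x -> constraint XX s' x.
Proof.
move=> ss' /hasP[X XXX /allP sX]; apply/hasP; exists X => //.
apply/allP => y yX; apply: ss'; last exact: sX.
by rewrite /nbh addrC addKr; exact: nbrsP yX.
Qed.

Lemma constraint_shift s x y :
  constraint XX s (x + y) = constraint XX (fun z => s (x + z)) y.
Proof.
by apply: eq_has => X; apply: eq_all => z; rewrite addrA.
Qed.

Definition ht (x : site) : int := \sum_(i < d) x 0 i * v 0 i.

Lemma ht0 : ht 0 = 0.
Proof. by rewrite /ht big1// => i _; rewrite mxE mul0r. Qed.

Lemma htD x y : ht (x + y) = ht x + ht y.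
Proof. by rewrite /ht -big_split; apply: eq_bigr => i _; rewrite mxE mulrDl. Qed.

Lemma htN x : ht (- x) = - ht x.
Proof. by rewrite /ht -sumrN; apply: eq_bigr => i _; rewrite mxE mulNr. Qed.

Hypothesis nbrs_ht : forall y, y \in nbrs -> 0 < ht y.

Lemma nbh_ht x y : nbh x y -> ht x < ht y.
Proof. by move/nbrs_ht; rewrite htD htN subr_gt0. Qed.

Definition aperture : nat := \max_(y <- nbrs) \max_(i < d) absz (y ord0 i).

(** A decidable enlargement of the semigroup generated by [nbrs]: it is stable under addition,
    contains the neighbours because their heights are at least 1, and has finitely many sites of
    each height. *)
Definition in_cone (x : site) : bool :=
  (0 <= ht x) && [forall i, `|x 0 i| <= aperture%:Z * ht x].

Lemma in_coneP x : reflect (0 <= ht x /\ forall i, `|x 0 i| <= aperture%:Z * ht x)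
  (in_cone x).
Proof.
apply: (iffP andP) => -[h1 h2]; split => //; first exact/forallP.
exact/forallP.
Qed.

Lemma in_cone0 : in_cone 0.
Proof.
by apply/in_coneP; rewrite ht0 mulr0; split => // i; rewrite mxE normr0.
Qed.

Lemma in_coneD x y : in_cone x -> in_cone y -> in_cone (x + y).
Proof.
move=> /in_coneP[hx kx] /in_coneP[hy ky]; apply/in_coneP; rewrite htD.
split=> [|i]; first exact: addr_ge0.
by rewrite mxE mulrDr (le_trans (ler_normD _ _))// lerD.
Qed.

Lemma in_cone_nbrs y : y \in nbrs -> in_cone y.
Proof.
move=> yN; have hy := nbrs_ht yN; apply/in_coneP; split=> [|i]; first exact: ltW.
have yA : (absz (y ord0 i) <= aperture)%N.
  apply: leq_trans (@leq_bigmax_seq _ nbrs xpredT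
    (fun y : site => \max_(i < d) absz (y ord0 i)) y yN isT).
  exact: (@leq_bigmax _ (fun i => absz (y ord0 i))).
apply: (@le_trans _ _ aperture%:Z); first by rewrite -abszE lez_nat.
by rewrite ler_peMr// -gtz0_ge1.
Qed.

Lemma in_cone_ht0 x : in_cone x -> ht x = 0 -> x = 0.
Proof.
move=> /in_coneP[_ hx] x0; apply/rowP => i; rewrite mxE.
by have := hx i; rewrite x0 mulr0 normr_le0 => /eqP.
Qed.

Definition box (m : nat) : seq site :=
  map (fun f : {ffun 'I_d -> 'I_(m.*2).+1} => \row_i ((f i : nat)%:Z - m%:Z))
      (enum {ffun 'I_d -> 'I_(m.*2).+1}).

Lemma mem_box m (x : site) : (forall i, `|x 0 i| <= m%:Z) -> x \in box m.
Proof.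
move=> xm; apply/mapP.
exists [ffun i => inord (absz (x ord0 i + m%:Z))]; first by rewrite mem_enum.
apply/rowP => i; rewrite mxE ffunE.
change (x ord0 i = (inord (absz (x ord0 i + m%:Z)) : 'I_(m.*2).+1)%:Z - m%:Z).
have : `|x ord0 i| <= m%:Z := xm i.
by move: (x ord0 i) => a; rewrite ler_norml => am; rewrite inordK; lia.
Qed.

Lemma size_box m : size (box m) = ((m.*2).+1 ^ d)%N.
Proof. by rewrite size_map -cardE card_ffun !card_ord. Qed.

(* The sites that can influence the origin from height at most [n], highest
   first: the order in which the oriented dynamics fills them. *)
Definition cone (n : nat) : seq site :=
  sort (fun x y => ht y <= ht x)
    (undup [seq x <- box (aperture * n) | in_cone x & ht x <= n%:Z]).

Lemma mem_cone n x : (x \in cone n) = in_cone x && (ht x <= n%:Z).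
Proof.
rewrite mem_sort mem_undup mem_filter andb_idr// => /andP[/in_coneP[h0 hx] hn].
by apply: mem_box => i; rewrite (le_trans (hx i))// PoszM ler_wpM2l.
Qed.

Lemma cone_uniq n : uniq (cone n).
Proof. by rewrite sort_uniq undup_uniq. Qed.

Lemma cone_sorted n : sorted (fun x y => ht y <= ht x) (cone n).
Proof. by apply: sort_sorted => x y; exact: le_total. Qed.

Lemma sorted_ordered l : uniq l -> sorted (fun x y => ht y <= ht x) l ->
  ordered nbh l.
Proof.
move=> ul sl; split=> // l1 x l2 E y yl2; apply/negP => /nbh_ht; apply/negP.
rewrite -leNgt; move: yl2; rewrite inE => /predU1P[->//|yl2].
have tr : transitive (fun x y => ht y <= ht x).
  by move=> a b e h1 h2; exact: le_trans h2 h1.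
move: sl; rewrite E => /cat_sorted2[_] /=.
by rewrite (path_sortedE tr) => /andP[/allP /(_ _ yl2)].
Qed.

Lemma cone_ordered n : ordered nbh (cone n).
Proof. exact: sorted_ordered (cone_uniq n) (cone_sorted n). Qed.

Lemma cone0_in n : 0 \in cone n.
Proof. by rewrite mem_cone in_cone0 ht0. Qed.

Lemma sub_cone m n : (m <= n)%N -> {subset cone m <= cone n}.
Proof.
by move=> mn x; rewrite !mem_cone => /andP[-> /le_trans]; apply; rewrite lez_nat.
Qed.

Lemma cone_add n x y : x \in cone n -> y \in cone (n - `|ht x|)%N ->
  x + y \in cone n.
Proof.
rewrite !mem_cone => /andP[kx hx] /andP[ky hy]; rewrite in_coneD//= htD.
by have /in_coneP[hx0 _] := kx; lia.
Qed.

Lemma cone_nbrs n x y : x \in cone n -> y \in nbrs -> ht (x + y) <= n%:Z ->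
  x + y \in cone n.
Proof.
by rewrite !mem_cone => /andP[kx _] /in_cone_nbrs ky ->; rewrite in_coneD.
Qed.

Lemma size_cone n : (size (cone n) <= ((aperture * n).*2.+1) ^ d)%N.
Proof.
rewrite size_sort (leq_trans (size_undup _))// size_filter.
by rewrite (leq_trans (count_size _ _))// size_box.
Qed.

End cone.

(** * Sharpness for the crossing probabilities *)

Lemma sum_ord_shift (R : zmodType) (p : nat -> R) (a n : nat) :
  \sum_(k < n | (a <= k)%N) p (k - a)%N = \sum_(j < n - a) p j.
Proof.
elim: n => [|n IH]; first by rewrite sub0n !big_ord0.
rewrite big_mkcond big_ord_recr/= -big_mkcond/= IH; case: leqP => [an|na].
  by rewrite subSn// big_ord_recr.
by rewrite addr0 (eqP (ltnW na)) (eqP na).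
Qed.

Section crossing.
Context {R : realType} {d : nat}.
Local Notation site := 'rV[int]_d.
Variables (XX : {fset {fset site}}) (v : site).
Hypothesis nbrs_ht : forall y, y \in nbrs XX -> 0 < ht v y.
Local Notation c := (constraint XX).
Local Notation cone := (cone XX v).
Local Notation fill := (fill c).
Local Notation ht := (ht v).

Definition closed_at n (s : site -> bool) : R := (~~ fill (cone n) s 0)%:R.

Definition blocked_at n (s : site -> bool) : R := (~~ c (fill (cone n) s) 0)%:R.

Definition theta n (q : R) : R := mean q (cone n) (closed_at n).

Let co := cone_ordered nbrs_ht.

Let chomo := @constraint_homo d XX.

Lemma closed_dep n : dep_on [in cone n] (closed_at n).
Proof. by move=> s s' /fill_dep ss'; rewrite /closed_at ss'. Qed.

Lemma blocked_dep n : dep_on [in cone n] (blocked_at n).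
Proof. by move=> s s' /fill_dep ss'; rewrite /blocked_at ss'. Qed.

Lemma closed_blocked n s : closed_at n s = (~~ s 0)%:R * blocked_at n s.
Proof.
rewrite /closed_at (fill_fix chomo _ (co n) (cone0_in _ _ n)) negb_or.
by rewrite /blocked_at; case: (s 0) => /=; rewrite ?mul0r ?mul1r.
Qed.

Lemma theta_blocked n q : theta n q = (1 - q) * mean q (cone n) (blocked_at n).
Proof.
rewrite /theta (eq_mean q _ (closed_blocked n)).
rewrite -(mean_avg q _ (cone0_in XX v n)) -meanZ; apply: eq_mean => s.
rewrite /avg !upd_same /= mul0r mulr0 add0r mul1r; congr (_ * _).
by rewrite /blocked_at (c_fill_indep chomo (co n) (cone0_in XX v n)).
Qed.

Lemma closed_ge0 n s : 0 <= closed_at n s. Proof. exact: ler0n. Qed.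
Lemma closed_le1 n s : closed_at n s <= 1. Proof. by rewrite lern1 leq_b1. Qed.

Lemma closed_le m n s : (m <= n)%N -> closed_at n s <= closed_at m s.
Proof.
move=> mn; rewrite ler_nat; have := @fill_sub _ c _ chomo _ _ s 0 (co n) (sub_cone mn).
by case: (fill (cone m) s 0) => [->//|_]; exact: leq_b1.
Qed.

Lemma grad_closed_le0 n x s : grad x (closed_at n) s <= 0.
Proof.
rewrite subr_le0 ler_nat.
have := @fill_homo _ c _ chomo _ (upd s x false) (upd s x true) 0 (co n).
case: (fill _ (upd s x false) 0) => [->//|_]; last exact: leq_b1.
by move=> y; rewrite !updE; case: eqP.
Qed.

Let shift (x : site) (s : site -> bool) : site -> bool := fun z => s (x + z).

Lemma upd_shift x y (s : site -> bool) b :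
  shift x (upd s (x + y) b) = upd (shift x s) y b.
Proof.
by apply/funext => z; rewrite updE /shift updE (inj_eq (addrI x)).
Qed.

Lemma av_shift q x l (F : (site -> bool) -> R) s :
  av q (map (+%R x) l) (fun s => F (shift x s)) s = av q l F (shift x s).
Proof. by elim: l s => //= y l IH s; rewrite /avg !IH !upd_shift. Qed.

Lemma fill_shift x l s y : fill (map (+%R x) l) s (x + y) = fill l (shift x s) y.
Proof.
elim/last_ind: l y => // l z IH y; rewrite map_rcons !fill_rcons !updE.
rewrite (inj_eq (addrI x)) IH; case: eqP => // _; congr (_ || _).
by rewrite constraint_shift; congr (constraint XX _ _); apply/funext.
Qed.

(** The cone of height [k - ht x] translated to [x] lies inside [cone k], and a smaller region fills
    fewer sites; hence a site blocked in [cone k] is blocked in its own cone. *)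
Lemma blocked_shift q n k x : 0 <= q <= 1 -> (k <= n)%N -> x \in cone k ->
  mean q (cone n) (fun s => (~~ c (fill (cone k) s) x)%:R) <=
  mean q (cone (k - `|ht x|)%N) (blocked_at (k - `|ht x|)%N).
Proof.
move=> q01 kn xk; set m := (k - _)%N.
have sub : {subset map (+%R x) (cone m) <= cone k}.
  by move=> _ /mapP[y ym ->]; exact: cone_add.
apply: le_trans (_ : _ <= mean q (cone n) (fun s => blocked_at m (shift x s))) _.
  apply: ler_mean => // s; rewrite /blocked_at.
  rewrite ler_nat -[x in c _ x]addr0 constraint_shift.
  case: (boolP (c (fill (cone m) _) 0)) => [cm|_]; last exact: leq_b1.
  rewrite leqn0 eqb0 negbK; apply: chomo cm => y _; rewrite -fill_shift.
  exact: (fill_sub chomo (co k) sub).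
rewrite (@mean_supp _ _ q (map (+%R x) (cone m)) (cone n)).
- by rewrite /mean av_shift (av_dep_on q _ (@blocked_dep m)).
- move=> s s' ss'; apply: blocked_dep => y ym; apply: ss'.
  exact: map_f.
- by move=> y /sub; exact: sub_cone.
Qed.

(** As [closed_at n] is nonincreasing in each site, the absolute values can be removed, which turns
    the influence in the OSSS inequality into a term of Russo's derivative. *)
Lemma mean_abs_sub q n x : x \in cone n ->  0 <= q <= 1 ->
  mean q (cone n) (fun s => `|closed_at n s - avg q x (closed_at n) s|) =
  2 * (q * (1 - q)) * - mean q (cone n) (grad x (closed_at n)).
Proof.
move=> xn q01; rewrite -(mean_avg q _ xn) -meanN -meanZ.
have /andP[q0 q1] := q01; rewrite -subr_ge0 in q1.
apply: eq_mean => s; rewrite {1}/avg !sub_avg !indep_grad !upd_same !normrM.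
rewrite (ler0_norm (grad_closed_le0 _ _ _)) sub0r normrN !ger0_norm//.
by rewrite mulr1n; ring.
Qed.

Lemma theta_ge0 n q : 0 <= q <= 1 -> 0 <= theta n q.
Proof. by move=> q01; apply: mean_ge0 => // s; exact: closed_ge0. Qed.

Lemma blocked_ge0 n q : 0 <= q <= 1 -> 0 <= mean q (cone n) (blocked_at n).
Proof. by move=> q01; apply: mean_ge0 => // s; exact: ler0n. Qed.

Lemma theta_le n q : 0 <= q <= 1 -> theta n q <= 1 - q.
Proof.
move=> q01; have /andP[_ q1] := q01; rewrite theta_blocked ler_piMr ?subr_ge0//.
by rewrite -[leRHS](mean_cst q (cone n)) ler_mean// => s; rewrite lern1 leq_b1.
Qed.

Lemma theta_closed_cov q n k : (k <= n)%N ->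
  mean q (cone n) (fun s => closed_at n s * closed_at k s) = theta n q.
Proof.
move=> kn; apply: eq_mean => s; rewrite /closed_at -natrM mulnb.
have := closed_le s kn; rewrite /closed_at.
by case: (~~ fill (cone n) s 0); case: (~~ fill (cone k) s 0) => //=; rewrite ler10.
Qed.

(** The OSSS inequality is applied, for each [k < n], to [closed_at n] and the exploration deciding
    [closed_at k]. Their covariance [theta n q * (1 - theta k q)] is at least [q * theta n q], and
    summing over [k] turns the reading probabilities into the sum of the [theta k q]. *)
Lemma theta_diff q n : 0 < q < 1 -> n%:R * theta n q <=
  2 * (\sum_(k < n) theta k q) * - \sum_(x <- cone n) mean q (cone n) (grad x (closed_at n)).
Proof.
move=> /[dup] q01 /andP[q0 q1].
have q01' : 0 <= q <= 1 by rewrite !ltW.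
pose I x := - mean q (cone n) (grad x (closed_at n)).
have I0 x : 0 <= I x.
  by rewrite /I -meanN mean_ge0// => s; rewrite oppr_ge0 grad_closed_le0.
have c0 : 0 <= 2 * (q * (1 - q)).
  by apply: mulr_ge0 => //; apply: mulr_ge0; rewrite ?subr_ge0 ltW.
pose p k := mean q (cone k) (blocked_at k).
have p0 k : 0 <= p k by rewrite mean_ge0// => s; exact: ler0n.
have step (k : 'I_n) : q * theta n q <=
    \sum_(x <- cone k) p (k - `|ht x|)%N * (2 * (q * (1 - q)) * I x).
  have kn : (k <= n)%N by rewrite ltnW.
  have thk : mean q (cone n) (closed_at k) = theta k q.
    by rewrite (mean_supp q (@closed_dep k) (sub_cone kn)).
  apply: le_trans (_ : _ <= `|mean q (cone n) (fun s => closed_at n s * closed_at k s) -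
    mean q (cone n) (closed_at n) * mean q (cone n) (closed_at k)|) _.
    rewrite theta_closed_cov// thk -/(theta n q) -[X in X - _]mulr1 -mulrBr.
    have thk1 := theta_le k q01'; have thn0 := theta_ge0 n q01'.
    by rewrite ger0_norm; [rewrite mulrC ler_wpM2l//|rewrite mulr_ge0//]; lra.
  pose r x s := ~~ c (fill (cone k) s) x.
  apply: le_trans (@osss _ _ q q01' (cone n) (cone k) (closed_at n) (closed_at k) r
    (cone_uniq _ _ k) (sub_cone kn) _ (@closed_dep k) _) _.
  - by move=> s; rewrite ger0_norm ?closed_ge0// closed_le1.
  - move=> l1 x l2 E; split.
      by move=> s s' ss'; rewrite /r (c_fill_dep chomo (co k) E ss').
    move=> s b; rewrite /r negbK => cx; rewrite /closed_at (fill_upd chomo)//.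
    by rewrite E mem_cat mem_head orbT.
  rewrite big_seq [leRHS]big_seq; apply: ler_sum => x xk.
  rewrite mean_abs_sub ?(sub_cone kn)// ler_wpM2r//; first exact: mulr_ge0 c0 (I0 x).
  exact: blocked_shift.
have sumstep : n%:R * (q * theta n q) <=
    \sum_(x <- cone n) (\sum_(k < n) p k) * (2 * (q * (1 - q)) * I x).
  apply: le_trans (_ : _ <= \sum_(k < n) \sum_(x <- cone n | ht x <= k%:Z)
      p (k - `|ht x|)%N * (2 * (q * (1 - q)) * I x)) _.
    rewrite mulr_natl -[n in _ *+ n]card_ord -sumr_const; apply: ler_sum => k _.
    rewrite -big_filter (perm_big (cone k)) ?step// uniq_perm ?filter_uniq ?cone_uniq//.
    move=> x; rewrite mem_filter !mem_cone; case: in_cone => //=; rewrite ?andbF//.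
    by have := ltn_ord k; lia.
  (* For fixed [x] the indices [k - ht x] are distinct, so the sum over [k] is at most the full sum
     of the [p k]. *)
  rewrite (exchange_big_dep xpredT)//= big_seq [leRHS]big_seq; apply: ler_sum => x xn.
  rewrite -mulr_suml ler_wpM2r//.
    exact: mulr_ge0 c0 (I0 x).
  have hx0 : 0 <= ht x by move: xn; rewrite mem_cone => /andP[/in_coneP[]].
  rewrite [leLHS](eq_bigl (fun k : 'I_n => (`|ht x| <= k)%N)); last first.
    by move=> k; rewrite -lez_nat abszE ger0_norm.
  rewrite sum_ord_shift (big_ord_widen n p (leq_subr _ n)) big_mkcond/=.
  by apply: ler_sum => k _; case: ifP => // _; exact: blocked_ge0.
have qE : n%:R * (q * theta n q) = q * (n%:R * theta n q) by rewrite mulrCA.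
rewrite -(ler_pM2l q0) -qE; apply: (le_trans sumstep).
have thS : \sum_(k < n) theta k q = (1 - q) * \sum_(k < n) p k.
  by rewrite mulr_sumr; apply: eq_bigr => k _; rewrite theta_blocked.
rewrite thS -sumrN -[\sum_(x <- cone n) - _]/(\sum_(x <- cone n) I x).
rewrite -!mulr_sumr le_eqVlt; apply/orP; left; apply/eqP; ring.
Qed.

End crossing.

(** * Local functions under the product measure *)

Section bridge.
Context {R : realType} {d : nat}.
Local Notation site := 'rV[int]_d.
Variable q : R.
Hypothesis q01 : 0 <= q <= 1.
Local Notation P := (@bernoulli_product R d q).

Lemma site_averageE x (f : config site -> R) : site_average q x f = avg q x f.
Proof. by apply/funext => s; rewrite /site_average big_bool. Qed.

Lemma av_upd l x b (f : (site -> bool) -> R) s : x \notin l ->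
  av q l (fun s => f (upd s x b)) s = av q l f (upd s x b).
Proof.
elim: l s => //= y l IH s; rewrite inE negb_or => /andP[xy xl].
by rewrite /avg !IH// !(updC _ _ _ xy).
Qed.

Definition cylinder (S : {fset site}) (b : site -> bool) : set (config site) :=
  [set s | forall x, x \in S -> s x = b x].

Lemma measurable_cylinder S b : measurable (cylinder S b).
Proof.
have -> : cylinder S b = \bigcap_(x in [set` S]) [set s | s x = b x].
  by apply/seteqP; split.
apply: fin_bigcap_measurable => [|x _]; first exact: finite_fset.
apply: sub_sigma_algebra; exists x => //=; exists [set b x] => //.
by apply/seteqP; split => s /=; [case|].
Qed.

Definition weight (S : {fset site}) (b : site -> bool) : R :=
  \prod_(x <- S) (if b x then q else 1 - q).

Lemma prob_cylinder S b : P (cylinder S b) = (weight S b)%:E.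
Proof.
rewrite /cylinder (@product_probabilityE R site (bernoulli_prob q) S (fun x => [set b x])).
rewrite /weight -prodEFin; apply: eq_bigr => x _.
apply: etrans (bernoulli_probE q01 [set b x]) _; rewrite !diracE; case: (b x).
  by rewrite mem_set// memNset//= mule1 mule0 adde0.
by rewrite memNset//= mem_set// mule0 mule1 add0e.
Qed.

(** The cylinder records the sites already treated: the induction splits on the value of [x] and
    moves it from [f] into the cylinder, until [f] is constant. *)
Lemma integral_cylinder l (f : config site -> R) S b : uniq l ->
  {in l, forall x, x \notin S} -> dep_on [in l] f ->
  P.-integrable setT (fun s => (f s * \1_(cylinder S b) s)%:E) /\
  (\int[P]_s (f s * \1_(cylinder S b) s)%:E = (mean q l f * weight S b)%:E)%E.
Proof.
elim: l f S b => [|x l IH] f S b /= => [_ _ lf|/andP[xl ul] xlS lf].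
  have -> : (fun s => (f s * \1_(cylinder S b) s)%:E) =
            (fun s => (mean q [::] f)%:E * (\1_(cylinder S b) s)%:E)%E.
    by apply/funext => s; rewrite EFinM; congr (_%:E * _)%E; exact: lf.
  have mc := measurable_cylinder S b.
  have ic := @integrable_indic _ _ _ P _ mc.
  split; first exact: integrableZl.
  by rewrite integralZl//= integral_indic// setIT [X in (_ * X)%E]prob_cylinder EFinM.
have xS : x \notin S by apply: xlS; rewrite mem_head.
pose fb c s := f (upd s x c).
pose S' := (x |` S)%fset.
have lS' : {in l, forall y, y \notin S'}.
  move=> y yl; rewrite !inE negb_or xlS ?inE ?yl ?orbT// andbT.
  by apply: contraNneq xl => <-.
have lfb c : dep_on [in l] (fb c).
  move=> s s' ss'; apply: lf => y; rewrite inE !updE => /orP[->//|yl].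
  by case: eqP => // _; exact: ss'.
have cylE c s : (\1_(cylinder S' (upd b x c)) s : R) =
    (s x == c)%:R * \1_(cylinder S b) s.
  rewrite !indicE -natrM mulnb; congr (_%:R); congr nat_of_bool.
  apply/idP/idP => [/set_mem sS'|/andP[/eqP sx /set_mem sS]].
    apply/andP; split; first by rewrite (sS' x) ?fset1U1// upd_same.
    apply/mem_set => y yS; rewrite (sS' y) ?fset1Ur// updE.
    by case: eqP yS xS => // -> ->.
  apply/mem_set => y; rewrite inE in_fset1 => /orP[/eqP ->|yS]; first by rewrite upd_same.
  by rewrite sS// updE; case: eqP yS xS => // -> ->.
have wE c : weight S' (upd b x c) = (if c then q else 1 - q) * weight S b.
  rewrite /weight big_fsetU1//= upd_same; congr (_ * _).
  apply: eq_big_seq => y yS; rewrite updE.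
  by case: eqP yS xS => // -> ->.
have fE : (fun s => (f s * \1_(cylinder S b) s)%:E) =
  (fun s => (fb true s * \1_(cylinder S' (upd b x true)) s)%:E +
            (fb false s * \1_(cylinder S' (upd b x false)) s)%:E)%E.
  apply/funext => s; rewrite -EFinD !cylE /fb -{1}(upd_id s x).
  by case: (s x) => /=; congr EFin; ring.
have [It Et] := IH _ _ (upd b x true) ul lS' (lfb true).
have [If Ef] := IH _ _ (upd b x false) ul lS' (lfb false).
split; first by rewrite fE; exact: integrableD.
rewrite fE integralD//= Et Ef -EFinD !wE; congr EFin.
by rewrite /mean /= /avg /fb !av_upd//; ring.
Qed.

Lemma local_integrable l (f : config site -> R) : dep_on [in l] f ->
  P.-integrable setT (EFin \o f) /\ ('E_P[f] = (mean q l f)%:E)%E.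
Proof.
move=> lf; have uf : dep_on [in undup l] f.
  by apply: sub_dep_on lf => x /=; rewrite mem_undup.
have H := @integral_cylinder (undup l) f fset0 (fun=> false) (undup_uniq l).
have cyl0 : (\1_(cylinder fset0 (fun=> false)) : config site -> R) = cst 1.
  by apply/funext => s; rewrite indicE mem_set.
have fE : (fun s => (f s * \1_(cylinder fset0 (fun=> false)) s)%:E) = EFin \o f.
  by apply/funext => s; rewrite cyl0 mulr1.
rewrite fE in H; case: H => // I E; split=> //.
rewrite unlock E /weight big_seq_fset0 mulr1.
by rewrite (mean_supp q uf)// => x; rewrite mem_undup.
Qed.

Lemma expectation_mean l (f : config site -> R) : dep_on [in l] f ->
  ('E_P[f] = (mean q l f)%:E)%E.
Proof. by move=> /local_integrable[]. Qed.

Lemma prob_mean l (b : config site -> bool) : dep_on [in l] b ->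
  P [set s | b s] = (mean q l (fun s => (b s)%:R))%:E.
Proof.
move=> lb; pose f : config site -> R := fun s => (b s)%:R.
have lf : dep_on [in l] f by move=> s s' ss'; rewrite /f (lb _ s').
have [/integrableP[mf _] <-] := local_integrable lf.
have fE : f = \1_[set s | b s].
  apply/funext => s; rewrite indicE /f; congr (nat_of_bool _)%:R.
  by apply/idP/idP => [bs|/set_mem//]; exact: mem_set.
have mA : measurable ([set s | b s] : set (config site)).
  rewrite (_ : [set s | b s] = f @^-1` [set 1]); last first.
    apply/seteqP; split => s /=; rewrite /f; first by move->.
    by case: (b s) => // /eqP; rewrite eq_sym oner_eq0.
  rewrite -[X in measurable X]setTI; move/measurable_EFinP : mf; apply => //.
by rewrite -/f fE expectation_indic.
Qed.

Lemma variance_mean l (f : config site -> R) : dep_on [in l] f ->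
  ('V_P[f] = (mean q l (fun s => f s ^+ 2) - mean q l f ^+ 2)%:E)%E.
Proof.
move=> lf; rewrite /variance covariance.unlock (expectation_mean lf) /=.
set m := mean q l f; rewrite [X in expectation _ X](_ : _ = fun s => (f s - m) ^+ 2)//.
rewrite (@expectation_mean l); last by move=> s s' ss'; rewrite (lf _ s').
congr EFin.
rewrite (@eq_mean _ _ q l _ (fun s => f s ^+ 2 + (- (2 * m) * f s + m ^+ 2))).
  by rewrite !meanD meanZ mean_cst -/m; ring.
by move=> s; ring.
Qed.

Lemma constraint_dep (XX : {fset {fset site}}) (l : seq site) (x : site) :
  (forall (X : {fset site}) y, X \in XX -> y \in X -> x + y \in l) ->
  dep_on [in l] (fun s : site -> bool => constraint XX s x).
Proof.
move=> lX s s' ss'; rewrite /constraint; apply: eq_in_has => X XXX.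
by apply: eq_in_all => y yX; apply: ss'; exact: lX yX.
Qed.

Lemma generatorE XX (S : {fset site}) (f : config site -> R) s :
  dep_on [in S] f ->
  generator XX q f s = \sum_(x <- S) (constraint XX s x)%:R * (avg q x f s - f s).
Proof.
move=> Sf; rewrite /generator (@fsbigTE _ _ _ _ S).
  by apply: eq_bigr => x _; rewrite site_averageE.
move=> x xS; rewrite site_averageE avg_indep ?subrr ?mulr0//.
exact: dep_on_indep Sf _.
Qed.

(** The term of [x] is first averaged over [s x], which leaves the constraint at [x] unchanged and
    produces the squared gradient. *)
Lemma dirichlet_form (XX : {fset {fset site}}) (S : {fset site}) (L : seq site)
    (f : config site -> R) :
  dep_on [in S] f -> {subset S <= L} -> (forall x, indep x (constraint XX ^~ x)) ->
  (forall x (X : {fset site}) y, x \in S -> X \in XX -> y \in X -> x + y \in L) ->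
  ('E_P[f \* generator XX q f] =
   (- (q * (1 - q) * \sum_(x <- S)
      mean q L (fun s => (constraint XX s x)%:R * grad x f s ^+ 2)))%:E)%E.
Proof.
move=> Sf SL ci XL.
have Lf : dep_on [in L] f by apply: sub_dep_on Sf => x; exact: SL.
pose D x s := (constraint XX s x)%:R * (f s * (avg q x f s - f s)).
have -> : f \* generator XX q f = fun s => \sum_(x <- S) D x s.
  apply/funext => s /=; rewrite (generatorE _ _ Sf) mulr_sumr.
  by apply: eq_bigr => x _; rewrite mulrCA.
rewrite (@expectation_mean L); last first.
  move=> s s' ss'; rewrite big_seq [RHS]big_seq; apply: eq_bigr => x xS.
  rewrite /D (@constraint_dep XX L x _ _ _ ss'); last first.
    by move=> X y; exact: XL.
  have -> : avg q x f s = avg q x f s'.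
    by apply: (dep_on_avg q (x := x) Lf) => y /= /andP[yL _]; exact: ss'.
  by rewrite (Lf _ _ ss').
congr EFin; rewrite mean_sum mulr_sumr -sumrN big_seq [RHS]big_seq.
apply: eq_bigr => x xS; rewrite -(mean_avg q _ (SL _ xS)) -mulNr -meanZ.
apply: eq_mean => s; rewrite /D /avg !ci !updK /grad; ring.
Qed.

Lemma variance_deterministic l (f : (site -> bool) -> R) : q * (1 - q) = 0 ->
  mean q l (fun s => f s ^+ 2) = mean q l f ^+ 2.
Proof.
move=> qq0; rewrite /mean; move: (fun=> false).
elim: l => //= x l IH s; apply/eqP; rewrite -subr_eq0 (_ : avg q x _ s =
  avg q x (fun s => av q l f s ^+ 2) s) ?avg_sqr ?qq0 ?mul0r//.
by congr (avg _ _ _ _); apply/funext.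
Qed.

End bridge.

(** * The Poincaré inequality above criticality *)

Section supercritical.
Context {R : realType} {d : nat}.
Local Notation site := 'rV[int]_d.
Variables (XX : {fset {fset site}}) (v : site).
Hypothesis nbrs_ht : forall y, y \in nbrs XX -> 0 < ht v y.
Local Notation c := (constraint XX).
Local Notation cone := (cone XX v).
Local Notation fill := (fill c).
Local Notation ht := (ht v).
Local Notation nbh := (nbh XX).
Let co := cone_ordered nbrs_ht.
Let chomo := @constraint_homo d XX.

Lemma nbh_irr x : ~~ nbh x x.
Proof. by apply/negP => /(nbh_ht nbrs_ht); rewrite ltxx. Qed.

Lemma constraint_indep x : indep x (c^~ x).
Proof. exact: (c_indep chomo (nbh_irr x)). Qed.

Definition reach : nat := \max_(y <- nbrs XX) absz (ht y).

Lemma absz_ht_nbrs z : z \in nbrs XX -> (absz (ht z) <= reach)%N.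
Proof.
by move=> zN; exact: (@leq_bigmax_seq _ (nbrs XX) xpredT (fun y => absz (ht y)) _ zN isT).
Qed.

(** Influence descends by at most [reach] per time step, so height [t * reach] above [x] suffices
    for everything that can fill [x] by time [t]. *)
Lemma bootstrap_fill t n (s : site -> bool) x : in_cone XX v x ->
  ht x + (t * reach)%:Z <= n%:Z -> bootstrap XX t s x -> fill (cone n) s x.
Proof.
elim: t x => [|t IH] x kx hx.
  have xn : x \in cone n by rewrite mem_cone kx; move: hx; rewrite mul0n addr0.
  by rewrite (fill_fix chomo _ (co n) xn) => /= ->.
have hx' : ht x + (t * reach)%:Z <= n%:Z.
  by apply: le_trans hx; rewrite lerD2l lez_nat leq_mul2r leqnSn orbT.
have xn : x \in cone n.
  by rewrite mem_cone kx (le_trans _ hx')// lerDl.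
rewrite /= /bootstrap_step => /orP[|cx]; first exact: IH.
rewrite (fill_fix chomo _ (co n) xn); apply/orP; right.
apply: chomo cx => y xy; have := xy; rewrite /nbh => yN.
have yE : y = x + (y - x) by rewrite addrC subrK.
apply: IH; first by rewrite yE in_coneD// in_cone_nbrs.
have := absz_ht_nbrs yN.
have -> : ht y = ht x + ht (y - x) by rewrite -htD -yE.
move: hx; rewrite mulSn PoszD -lez_nat abszE => hx hr.
apply: le_trans hx; rewrite -addrA lerD2l lerD2r.
exact: le_trans (ler_norm _) hr.
Qed.

Fixpoint past (t : nat) (x : site) : seq site :=
  if t is t'.+1 then past t' x ++ flatten [seq past t' (x + y) | y <- nbrs XX]
  else [:: x].

Lemma bootstrap_dep t x : dep_on [in past t x] (fun s : site -> bool => bootstrap XX t s x).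
Proof.
elim: t x => [|t IH] x s s' ss' /=; first by apply: ss'; rewrite /= mem_head.
rewrite /bootstrap_step -!/(bootstrap _ _ _); congr (_ || _).
  by apply: IH => y yx; apply: ss'; rewrite /= mem_cat yx.
apply: (c_dep chomo) => y; rewrite /nbh => yN.
apply: IH => z zy; apply: ss'; rewrite /= mem_cat; apply/orP; right.
by apply/flatten_mapP; exists (y - x); rewrite // addrC subrK.
Qed.

Lemma prob_unfilled q t : 0 <= q <= 1 ->
  bernoulli_product q [set s | bootstrap XX t s 0 != true]%classic =
  (mean q (past t 0) (fun s => (bootstrap XX t s 0 != true)%:R : R))%:E.
Proof.
move=> q01; apply: (prob_mean q01 (b := fun s => bootstrap XX t s 0 != true)).
by move=> s s' ss'; rewrite (bootstrap_dep ss').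
Qed.

Lemma theta_le_unfilled q t n : 0 <= q <= 1 -> (t * reach <= n)%N ->
  theta XX v n q <= mean q (past t 0) (fun s => (bootstrap XX t s 0 != true)%:R : R).
Proof.
move=> q01 tn; pose L := cone n ++ past t 0.
rewrite /theta -(mean_supp (l' := L) q (@closed_dep R _ XX v n)); last first.
  by move=> x xn; rewrite mem_cat xn.
rewrite -(mean_supp (l' := L) q (f := fun s => (bootstrap XX t s 0 != true)%:R)).
- apply: ler_mean => // s; rewrite /closed_at ler_nat.
  case: (boolP (bootstrap XX t s 0)) => [b0|_]; last by rewrite leq_b1.
  by rewrite (bootstrap_fill (in_cone0 _ _) _ b0)// ht0 add0r lez_nat.
- by move=> s s' ss'; rewrite (bootstrap_dep ss').
- by move=> x xn; rewrite mem_cat xn orbT.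
Qed.

Definition punctured_cone n := [seq z <- cone n | z != 0].

(** Constraints look strictly upwards and heights in the cone are nonnegative, so no site of the
    cone reads the origin. The auxiliary constraint of a site can thus avoid the site itself. *)
Lemma fill_punctured n s : c (fill (cone n) s) 0 -> c (fill (punctured_cone n) s) 0.
Proof.
have po : ordered nbh (punctured_cone n).
  apply: (sorted_ordered nbrs_ht); first by rewrite filter_uniq// cone_uniq.
  apply: sorted_filter (cone_sorted _ _ _) => x y z h1 h2; exact: le_trans h2 h1.
have key y : fill (cone n) s y -> (y == 0) || fill (punctured_cone n) s y.
  apply: (fill_super chomo (F := fun y => (y == 0) || fill (punctured_cone n) s y)) => x xn; case: (eqVneq x 0) => //= x0.
  have xp : x \in punctured_cone n by rewrite mem_filter x0.
  rewrite (fill_fix chomo _ po xp) => /orP[->//|cx]; apply/orP; right.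
  apply: chomo cx => z xz /orP[/eqP z0|//].
  have := nbh_ht nbrs_ht xz; rewrite z0 ht0.
  by move: xn; rewrite mem_cone => /andP[/in_coneP[hx _] _]; rewrite ltNge hx.
apply: chomo => y y0 /key /orP[/eqP yE|//].
by move: y0; rewrite yE (negPf (nbh_irr 0)).
Qed.

Variables (q : R) (n : nat).
Hypothesis q01 : 0 < q < 1.
Let q01' : 0 <= q <= 1. Proof. by have /andP[/ltW-> /ltW->] := q01. Qed.

Let p := mean q (cone n) (blocked_at XX v n).
Let N := size (cone n).
Hypothesis p_small : 4 * p * N.+1%:R <= 1.

Let ball (x : site) := map (+%R x) (punctured_cone n).

Let size_ball x : (size (ball x) <= N)%N.
Proof. by rewrite size_map size_filter count_size. Qed.

Let ball_ht x y : y \in ball x -> ht x < ht y.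
Proof.
move=> /mapP[z]; rewrite mem_filter mem_cone => /andP[z0 /andP[kz _]] ->.
rewrite htD ltrDl lt_neqAle; have /in_coneP[-> _] := kz; rewrite andbT eq_sym.
by apply: contra z0 => /eqP /(in_cone_ht0 kz) ->.
Qed.

Let ball_uniq x : uniq (ball x).
Proof. by rewrite map_inj_uniq ?filter_uniq ?cone_uniq//; exact: addrI. Qed.

Variables (S : {fset site}) (f : (site -> bool) -> R).
Hypothesis Sf : dep_on [in S] f.

(** Sorted from the top so that [ball x] precedes [x] for every [x] in [S]; the translated
    neighbours make the constraints at sites of [S] depend on this list only. *)
Definition influence_zone : seq site :=
  sort (fun x y => ht y <= ht x)
    (undup (S ++ flatten [seq ball x | x <- S] ++
      flatten [seq [seq x + y | y <- nbrs XX] | x <- S])).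
Local Notation L := influence_zone.

Let uL : uniq L. Proof. by rewrite sort_uniq undup_uniq. Qed.

Let SL : {subset S <= L}.
Proof. by move=> x xS; rewrite mem_sort mem_undup mem_cat [x \in _]xS. Qed.

Let ballL x : x \in S -> {subset ball x <= L}.
Proof.
move=> xS y yx; rewrite mem_sort mem_undup !mem_cat; apply/orP; right.
by apply/orP; left; apply/flatten_mapP; exists x.
Qed.

Lemma nbrs_zone x (X : {fset site}) y :
  x \in S -> X \in XX -> y \in X -> x + y \in L.
Proof.
move=> xS XXX yX; rewrite mem_sort mem_undup !mem_cat; apply/orP; right.
apply/orP; right; apply/flatten_mapP; exists x => //; apply: map_f.
exact: nbrsP yX.
Qed.

Let before_ht x y : x \in L -> y \in L -> ht x < ht y -> y \in before L x.
Proof.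
move=> xL yL xy; rewrite /before in_take// ltnNge; apply/negP => ixy.
have tr : transitive (fun x y : site => ht y <= ht x).
  by move=> a b e h1 h2; exact: le_trans h2 h1.
have sL : sorted (fun x y => ht y <= ht x) L.
  by apply: sort_sorted => a b; exact: le_total.
have := sorted_leq_index tr (fun x => lexx (ht x)) sL x y xL yL ixy.
by rewrite leNgt xy.
Qed.

Let D x := mean q L (fun s => (c s x)%:R * grad x f s ^+ 2).

Let D_ge0 x : 0 <= D x.
Proof. by apply: mean_ge0 => // s; rewrite mulr_ge0 ?ler0n ?sqr_ge0. Qed.

Let D0 x : x \notin S -> D x = 0.
Proof.
move=> xS; rewrite /D -(mean_cst q L 0); apply: eq_mean => s.
by rewrite indep_gradP ?expr0n ?mulr0//; exact: dep_on_indep Sf xS.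
Qed.

(** Sites outside [S] get a trivial constraint: [f] ignores them, and their balls need not lie in
    [L]. *)
Let aux x (s : site -> bool) := (x \notin S) || c (fill (ball x) s) x.

Let aux_fail x : x \in S -> mean q L (fun s => (~~ aux x s)%:R) <= p.
Proof.
move=> xS; rewrite /aux xS /=.
pose F (s : site -> bool) : R := (~~ c (fill (punctured_cone n) s) 0)%:R.
have Fd : dep_on [in punctured_cone n] F.
  by move=> s s' ss'; rewrite /F (fill_dep c ss').
have FE s : (~~ c (fill (ball x) s) x)%:R = F (fun z => s (x + z)).
  rewrite /F -[x in c _ x]addr0 constraint_shift; congr (~~ c _ _)%:R.
  by apply/funext => y; rewrite fill_shift.
rewrite (eq_mean q L FE).
have -> : mean q L (fun s => F (fun z => s (x + z))) = mean q (ball x) (fun s => F (fun z => s (x + z))).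
  apply: mean_supp; last exact: ballL.
  by move=> s s' ss'; apply: Fd => y yp; apply: ss'; exact: map_f.
rewrite /mean av_shift (av_dep_on q _ Fd).
rewrite -(mean_supp q Fd (l' := cone n)); last first.
  by move=> y; rewrite mem_filter => /andP[].
apply: ler_mean => // s; rewrite /F /blocked_at ler_nat.
by case: (boolP (c (fill (cone n) s) 0)) => [/fill_punctured ->//|_]; exact: leq_b1.
Qed.

Let pc := path_cst q.

Let pc_ge1 : 1 <= pc.
Proof.
have /andP[q0 q1] := q01.
have h1 : 0 <= q^-1 by rewrite invr_ge0 ltW.
have h2 : 0 <= (1 - q)^-1 by rewrite invr_ge0 subr_ge0 ltW.
by rewrite /pc /path_cst; lra.
Qed.

Let aux_energy x : x \in S ->
  mean q L (fun s => (aux x s)%:R * grad x f s ^+ 2) <=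
  pc ^+ N * (D x + \sum_(y <- L | y \in ball x) D y).
Proof.
move=> xS; have xb : x \notin ball x.
  by apply/negP => /ball_ht; rewrite ltxx.
apply: le_trans (_ : _ <= mean q L
    (fun s => (c (legal_path c (ball x) s) x)%:R * grad x f s ^+ 2)) _.
  apply: ler_mean => // s; rewrite ler_wpM2r ?sqr_ge0// /aux xS /= ler_nat.
  case: (boolP (c (fill _ s) x)) => // cx; rewrite (chomo _ cx)// => y _.
  exact: (fill_legal_path chomo).
have nb y : y \in ball x -> ~~ nbh y x.
  by move=> /ball_ht xy; apply/negP => /(nbh_ht nbrs_ht); rewrite ltNge (ltW xy).
apply: (le_trans (path_energy chomo q01 f (SL xS) (ballL xS) xb nb)).
rewrite -/(D x); have -> : \sum_(y <- ball x) mean q L (fun s => (c s y)%:R * grad y f s ^+ 2)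
   = \sum_(y <- L | y \in ball x) D y.
  rewrite -[RHS]big_filter; apply: perm_big; rewrite uniq_perm ?filter_uniq//.
  by move=> y; rewrite mem_filter andb_idr// => /(ballL xS).
rewrite ler_wpM2r ?addr_ge0 ?sumr_ge0// ler_weXn2l//.
Qed.

(** The factor [4] comes from [auxiliary_poincare], [pc ^+ N] from legal paths of length at most
    [N], and [N.+1%:R] from the uses of each [D y]: once for [y] itself and once for every ball
    containing [y]. *)
Lemma poincare :
  mean q L (fun s => f s ^+ 2) - mean q L f ^+ 2 <=
  4 * pc ^+ N * N.+1%:R * (q * (1 - q) * \sum_(x <- S) D x).
Proof.
have /andP[q0 q1] := q01.
have qq0 : 0 <= q * (1 - q) by apply: mulr_ge0; rewrite ?subr_ge0 ltW.
pose B (x : site) : pred site := fun y => (x \in S) && (y \in ball x).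
have beforeB x : x \in L -> forall y, B x y -> y \in before L x.
  by move=> xL y /andP[xS yb]; apply: before_ht => //; [exact: ballL yb|exact: ball_ht].
have depB x : x \in L -> dep_on (B x) (aux x).
  move=> _ s s' ss'; rewrite /aux; have [xS|//] := boolP (x \in S).
  by congr (_ || c _ _); apply: fill_dep => y yb; apply: ss'; rewrite /B xS.
have failB x : x \in L -> mean q L (fun s => (~~ aux x s)%:R) <= p.
  move=> _; have [xS|xS] := boolP (x \in S); first exact: aux_fail.
  rewrite (_ : mean _ _ _ = 0) ?blocked_ge0// -(mean_cst q L 0).
  by apply: eq_mean => s; rewrite /aux xS.
have countB y : (count (fun x => y \in ball x) L <= N)%N.
  rewrite -size_filter /N -(size_map (fun z => y - z) (cone n)).
  apply: uniq_leq_size; first by rewrite filter_uniq.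
  move=> x; rewrite mem_filter => /andP[/mapP[z]].
  rewrite mem_filter => /andP[_ zn] -> _; apply/mapP; exists z => //.
  by rewrite addrK.
have countB' y : y \in L -> (count (fun x => B x y) L <= N)%N.
  move=> _; apply: leq_trans (countB y); apply: sub_count => x /= /andP[//].
have := auxiliary_poincare q01 f uL beforeB depB failB countB' p_small (blocked_ge0 _ _ n q01').
rewrite (_ : (fun s => av q L f s ^+ 2) = fun=> mean q L f ^+ 2); last first.
  apply/funext => s; rewrite av_dep_on//.
  by apply: sub_dep_on Sf => x; exact: SL.
rewrite mean_cst => /le_trans; apply.
have -> : \sum_(x <- S) D x = \sum_(x <- L) D x.
  rewrite [RHS](bigID (mem S))/= [X in _ + X]big1 ?addr0//.
  rewrite -[RHS]big_filter; apply: perm_big; rewrite uniq_perm ?filter_uniq ?fset_uniq//.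
  by move=> x; rewrite mem_filter andb_idr// => /SL.
have alg (a b w z : R) : 4 * a * b * (w * z) = 4 * w * (a * (b * z)) by ring.
rewrite alg {alg}.
rewrite ler_wpM2l//; first exact: mulr_ge0.
have pcN0 : 0 <= pc ^+ N by rewrite exprn_ge0// (le_trans ler01).
apply: le_trans (_ : _ <= \sum_(x <- L) pc ^+ N * (D x + \sum_(y <- L | y \in ball x) D y)) _.
  apply: ler_sum => x _; have [xS|xS] := boolP (x \in S); first exact: aux_energy.
  rewrite (_ : mean _ _ _ = 0); last first.
    rewrite -(mean_cst q L 0); apply: eq_mean => s.
    by rewrite indep_gradP ?expr0n ?mulr0//; exact: dep_on_indep Sf xS.
  by rewrite mulr_ge0// addr_ge0// sumr_ge0.
rewrite -mulr_sumr ler_wpM2l// big_split/= -natr1 mulrDl mul1r addrC lerD2r.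
rewrite (exchange_big_dep xpredT)//= mulr_sumr big_seq [leRHS]big_seq.
apply: ler_sum => y yL; rewrite big_const_seq iter_addr_0 -[leLHS]mulr_natl.
by rewrite ler_wpM2r// ler_nat countB.
Qed.

End supercritical.

(** * From the Poincaré inequality to a positive spectral gap *)

Section gap.
Context {R : realType} {d : nat}.
Local Notation site := 'rV[int]_d.
Variables (XX : {fset {fset site}}) (v : site).
Hypothesis nbrs_ht : forall y, y \in nbrs XX -> 0 < ht v y.
Local Notation c := (constraint XX).
Local Notation cone := (cone XX v).
Let chomo := @constraint_homo d XX.

Definition unfilled (q : R) (t : nat) : R :=
  mean q (past XX t 0) (fun s => (bootstrap XX t s 0 != true)%:R).

Lemma unfilled_ge0 (q : R) t : 0 <= q <= 1 -> 0 <= unfilled q t.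
Proof. by move=> q01; apply: mean_ge0 => // s; exact: ler0n. Qed.

Lemma unfilled_le (q : R) m n : 0 <= q <= 1 -> (m <= n)%N -> unfilled q n <= unfilled q m.
Proof.
move=> q01 /subnK <-; elim: (n - m)%N => // k IH; apply: le_trans IH.
rewrite addSn; set t := (k + m)%N; pose L := past XX t.+1 0.
rewrite /unfilled -(@mean_supp _ _ q (past XX t 0) L); last first.
- by move=> x; rewrite /L /= mem_cat => ->.
- by move=> s s' ss'; rewrite (bootstrap_dep ss').
apply: ler_mean => // s; rewrite ler_nat /= /bootstrap_step -/(bootstrap _ _ _).
by case: (bootstrap XX t s 0) => //=; exact: leq_b1.
Qed.

(** By [unfilled_le] the probabilities are nonincreasing in time, so arbitrarily small values are
    enough for convergence. *)
Lemma unfilled_cvg0P (q : R) : 0 <= q <= 1 ->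
  (fun t => bernoulli_product q [set s | bootstrap XX t s 0 != true]) @ \oo --> 0%E
  <-> forall e : R, 0 < e -> exists t, unfilled q t <= e.
Proof.
move=> q01.
have -> : (fun t => bernoulli_product q [set s | bootstrap XX t s 0 != true]) =
    (fun t => (unfilled q t)%:E).
  by apply/funext => t; rewrite prob_unfilled.
split.
  move=> /fine_cvg /cvgr0Pnorm_le H e e0; have [N _ HN] := H e e0.
  by exists N; have := HN N (leqnn N); rewrite /= ger0_norm// unfilled_ge0.
move=> H; apply: cvg_EFin; first by near=> t.
apply/cvgr0Pnorm_le => e e0; have [t te] := H e e0.
exists t => // n /= tn; rewrite ger0_norm ?unfilled_ge0//.
exact: le_trans (unfilled_le q01 tn) te.
Unshelve. all: by end_near. Qed.

Definition critical_set : set R := [set q : R | 0 <= q <= 1 /\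
  (fun t => bernoulli_product q [set s | bootstrap XX t s 0 != true]) @ \oo --> 0%E].

Lemma critical_set1 : critical_set 1.
Proof.
split; first by rewrite ler01 lexx.
have q01 : 0 <= (1 : R) <= 1 by rewrite ler01 lexx.
apply/(unfilled_cvg0P q01) => e e0; exists 0%N; rewrite /unfilled /=.
by rewrite /mean /= /avg /= !upd_same/= mulr0 subrr mul0r add0r ltW.
Qed.

Lemma theta_cvg0 (q : R) : critical_set q ->
  forall e : R, 0 < e -> exists n0, forall n, (n0 <= n)%N -> theta XX v n q <= e.
Proof.
move=> [q01 /(unfilled_cvg0P q01) H] e e0; have [t te] := H e e0.
exists (t * reach XX v)%N => n tn; apply: le_trans te.
exact: (theta_le_unfilled nbrs_ht).
Qed.

Lemma theta0 (q : R) : ~~ c (fun=> false) 0 -> theta XX v 0 q = 1 - q.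
Proof.
move=> c0; rewrite (theta_blocked nbrs_ht) (eq_mean _ _ (g := fun=> 1)).
  by rewrite mean_cst mulr1.
move=> s; rewrite /blocked_at (_ : c _ 0 = false)//; apply/negbTE.
apply: contra c0; apply: chomo => y yn; have [y0|y0] := boolP (y \in cone 0%N).
  move: y0 (yn); rewrite mem_cone => /andP[ky hy].
  have /in_coneP[hy' _] := ky.
  have -> : y = 0 by apply: (in_cone_ht0 ky); apply/eqP; rewrite eq_le hy hy'.
  by rewrite (negPf (nbh_irr nbrs_ht 0)).
by rewrite fill_out.
Qed.

Lemma supercritical_scale (q : R) : 0 < q < 1 -> q_c XX < q ->
  exists n, 4 * mean q (cone n) (blocked_at XX v n) * (size (cone n)).+1%:R <= 1.
Proof.
move=> /[dup] q01 /andP[q0 q1] qc.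
(* If the empty set belongs to [XX], every constraint always holds and nothing is ever blocked.
   Otherwise [theta 0] is positive below 1, as the decay lemma requires. *)
have [c0|c0] := boolP (c (fun=> false) 0).
  exists 0%N; rewrite (eq_mean _ _ (g := fun=> 0)).
    by rewrite mean_cst mulr0 mul0r.
  by move=> s; rewrite /blocked_at (_ : c _ 0 = true)//; exact: chomo c0.
have [q' [q'01 q'cvg] q'q] : exists2 q', critical_set q' & q' < q.
  by apply: inf_lt qc; exists 1; exact: critical_set1.
(* For positive [n] the cone has at most [A * n ^ d] sites; the [8 * A%:R] below absorbs the factor
   [4] and a doubling that covers the [.+1]. *)
pose A := ((aperture XX).*2.+1 ^ d)%N.
pose dth n (r : R) := \sum_(x <- cone n) mean r (cone n) (grad x (closed_at XX v n)).
have [n n0 nP] : exists2 n, (0 < n)%N &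
    n%:R ^+ d * theta XX v n q <= (1 - q) / (8 * A%:R).
  apply: (@superpolynomial_decay R (theta XX v) dth _ _ _ _ _ _ q') => //.
  - by move=> n r; apply: is_derive_mean; exact: cone_uniq.
  - move=> n r /andP[r0 r1]; rewrite -oppr_ge0 -sumrN sumr_ge0// => x _.
    rewrite -meanN mean_ge0 ?(ltW r0) ?(ltW r1)// => s; rewrite oppr_ge0.
    exact: (grad_closed_le0 nbrs_ht).
  - by move=> n r; exact: theta_ge0.
  - move=> n r r01; apply: (le_trans (theta_le nbrs_ht n r01)).
    by rewrite gerBl; case/andP: r01.
  - by move=> r r1; rewrite theta0// subr_gt0.
  - by move=> n r; exact: (theta_diff nbrs_ht).
  - by have /andP[] := q'01.
  - exact: (theta_cvg0 (conj q'01 q'cvg)).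
  - by rewrite divr_gt0 ?subr_gt0// mulr_gt0// ltr0n expn_gt0.
exists n; rewrite -(ler_pM2l (_ : 0 < 1 - q)) ?subr_gt0// mulr1.
have A0 : 0 < A%:R :> R by rewrite ltr0n expn_gt0.
have szn : ((size (cone n)).+1 <= 2 * (A * n ^ d))%N.
  have h : (size (cone n) <= A * n ^ d)%N.
    apply: leq_trans (size_cone _ _ _) _; rewrite /A -expnMn.
    have mono a b e : (a <= b -> a ^ e <= b ^ e)%N.
      by move=> ab; elim: e => // e IH; rewrite !expnS leq_mul.
    by apply: mono; rewrite mulSn -doubleMl -[X in (X <= _)%N]add1n leq_add2r.
  have : (0 < A * n ^ d)%N by rewrite muln_gt0 !expn_gt0 n0.
  by move: h; move: (A * n ^ d)%N => B; lia.
apply: le_trans (_ : _ <= 4 * theta XX v n q * (2 * (A * n ^ d))%:R) _.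
  rewrite (theta_blocked nbrs_ht).
  rewrite [leLHS](_ : _ = 4 * ((1 - q) * mean q (cone n) (blocked_at XX v n)) *
     (size (cone n)).+1%:R); last by ring.
  rewrite ler_wpM2l ?ler_nat// -(theta_blocked nbrs_ht) mulr_ge0// theta_ge0// !ltW//.
move: nP; rewrite ler_pdivlMr ?mulr_gt0// !natrM natrX => nP.
apply: le_trans nP; rewrite le_eqVlt; apply/orP; left; apply/eqP; ring.
Qed.

Lemma rayleigh (q : R) (S : {fset site}) (L : seq site) (f : config site -> R) :
  0 <= q <= 1 -> dep_on [in S] f -> {subset S <= L} ->
  (forall x (X : {fset site}) y, x \in S -> X \in XX -> y \in X -> x + y \in L) ->
  (0 < 'V_(bernoulli_product q)[f])%E ->
  0 < mean q L (fun s => f s ^+ 2) - mean q L f ^+ 2 /\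
  (- 'E_(bernoulli_product q)[f \* generator XX q f] / 'V_(bernoulli_product q)[f])%E =
  (q * (1 - q) * (\sum_(x <- S) mean q L (fun s => (c s x)%:R * grad x f s ^+ 2)) /
   (mean q L (fun s => f s ^+ 2) - mean q L f ^+ 2))%:E.
Proof.
move=> q01 Sf SL XL.
have Lf : dep_on [in L] f by apply: sub_dep_on Sf => x; exact: SL.
rewrite (variance_mean q01 Lf) lte_fin => V0; split=> //.
rewrite (dirichlet_form q01 Sf SL (constraint_indep nbrs_ht) XL) -EFinN opprK.
by rewrite inver gt_eqF.
Qed.

Lemma supercritical_gap (q : R) : 0 <= q <= 1 -> q_c XX < q ->
  (0 < spectral_gap XX q)%E.
Proof.
move=> q01 qc; have /andP[q0 q1] := q01.
have qc0 : 0 <= q_c XX :> R.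
  by apply: lb_le_inf; [exists 1; exact: critical_set1|move=> r [/andP[]]].
have {}q0 : 0 < q := le_lt_trans qc0 qc.
suff [C C0 HC] : exists2 C : R, 0 < C & forall (S : {fset site}) (f : config site -> R),
    dep_on [in S] f -> (0 < 'V_(bernoulli_product q)[f])%E ->
    (C%:E <= (- 'E_(bernoulli_product q)[f \* generator XX q f] /
             'V_(bernoulli_product q)[f]))%E.
  apply: (@lt_le_trans _ _ C%:E); first by rewrite lte_fin.
  apply: le_ereal_inf_tmp => _ [f [[S Sf] V0] <-]; exact: HC Sf V0.
move: q1; rewrite le_eqVlt => /predU1P[q1|q1].
  exists 1 => // S f Sf; rewrite (variance_mean q01 Sf) variance_deterministic.
    by rewrite subrr lte_fin ltxx.
  by rewrite q1 subrr mulr0.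
have q01' : 0 < q < 1 by rewrite q0.
have [n nP] := supercritical_scale q01' qc.
pose K := 4 * path_cst q ^+ size (cone n) * (size (cone n)).+1%:R.
have K0 : 0 < K.
  rewrite /K !mulr_gt0 ?ltr0n// exprn_gt0// /path_cst mulr_gt0// !addr_gt0//.
    by rewrite invr_gt0.
  by rewrite invr_gt0 subr_gt0.
exists K^-1 => [|S f Sf V0]; first by rewrite invr_gt0.
pose L := influence_zone XX v n S.
have SL : {subset S <= L}.
  by move=> x xS; rewrite mem_sort mem_undup mem_cat [x \in _]xS.
have [V0' ->] := rayleigh q01 Sf SL (@nbrs_zone _ _ _ _ _) V0.
rewrite lee_fin ler_pdivlMr// mulrC ler_pdivrMr// mulrC.
exact: (poincare nbrs_ht q01' nP Sf).
Qed.

End gap.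

(** * Vanishing of the gap below criticality *)

Lemma sqr_sum_le (R : realFieldType) (I : Type) (r : seq I) (a : I -> R) :
  (\sum_(i <- r) a i) ^+ 2 <= (size r)%:R * \sum_(i <- r) a i ^+ 2.
Proof.
elim: r => [|i r IH]; first by rewrite !big_nil expr0n mulr0.
rewrite !big_cons /= -natr1; set A := \sum_(j <- r) a j in IH *.
set B := \sum_(j <- r) a j ^+ 2 in IH *.
have h : 2 * a i * A <= (size r)%:R * a i ^+ 2 + B.
  rewrite /A /B -sum1_size natr_sum mulr_suml mulr_sumr -big_split/=.
  apply: ler_sum => j _; rewrite mul1r -subr_ge0.
  by rewrite (_ : _ - _ = (a i - a j) ^+ 2) ?sqr_ge0//; ring.
rewrite sqrrD mulrDl !mulrDr mul1r -mulr_natl; lra.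
Qed.

Lemma absz_add_le (a b : int) (r : nat) :
  (absz b <= r)%N -> (absz (a + b)%R <= absz a + r)%N.
Proof. lia. Qed.

Section subcritical.
Context {R : realType} {d : nat}.
Local Notation site := 'rV[int]_d.
Variables (XX : {fset {fset site}}) (v : site).
Hypothesis nbrs_ht : forall y, y \in nbrs XX -> 0 < ht v y.
Local Notation c := (constraint XX).
Local Notation ht := (ht v).
Let chomo := @constraint_homo d XX.

Lemma fill_bootstrap l (s : site -> bool) y :
  fill c l s y -> bootstrap XX (size l) s y.
Proof.
elim/last_ind: l y => // l x IH y; rewrite fill_rcons updE size_rcons /=.
rewrite /bootstrap_step -/(bootstrap _ _ _); case: eqP => [->|_]; last by move=> /IH ->.
case/orP => [sx|cx]; apply/orP; [left|right].
  by elim: (size l) => //= t IHt; rewrite /bootstrap_step IHt.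
by apply: chomo cx => z _; exact: IH.
Qed.

Variables (q : R) (n : nat).
Hypothesis q01 : 0 < q < 1.
Let q01' : 0 <= q <= 1. Proof. by have /andP[/ltW-> /ltW->] := q01. Qed.
Let qq0 : 0 <= q * (1 - q).
Proof. by have /andP[? ?] := q01; apply: mulr_ge0; rewrite ?subr_ge0 ltW. Qed.
Let qq1 : q * (1 - q) <= 1.
Proof. by have /andP[? ?] := q01'; rewrite mulr_ile1// ?subr_ge0// gerBl. Qed.

Local Notation box := (cone XX v n).
Let N := size box.
Let co := cone_ordered nbrs_ht n.
Let ub : uniq box := cone_uniq XX v n.

Let N_gt0 : (0 < N)%N.
Proof. by rewrite /N; have := cone0_in XX v n; case: (cone _ _ _). Qed.

Let NR : 0 < N%:R :> R. Proof. by rewrite ltr0n. Qed.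

(* The dynamics in [box] with unfilled boundary condition, one uniformly chosen
   site being updated at each step. *)
Definition c_box (s : site -> bool) y := c (fun z => s z && (z \in box)) y.

Definition site_update y (f : (site -> bool) -> R) s : R :=
  f s + (c_box s y)%:R * (avg q y f s - f s).

Definition transition (f : (site -> bool) -> R) s : R :=
  N%:R^-1 * \sum_(y <- box) site_update y f s.

Let c_box_indep y : indep y (c_box^~ y).
Proof.
move=> s b; apply: (c_dep chomo) => z yz; rewrite updE.
by case: eqP yz => // ->; rewrite (negPf (nbh_irr nbrs_ht y)).
Qed.

Lemma c_box_dep y : dep_on [in box] (c_box^~ y).
Proof.
move=> s s' ss'; apply: (c_dep chomo) => z _.
by case: (boolP (z \in box)) => [/ss' ->//|]; rewrite !andbF.
Qed.

Lemma site_update_dep y f : dep_on [in box] f -> dep_on [in box] (site_update y f).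
Proof.
move=> bf s s' ss'; rewrite /site_update (c_box_dep y ss') (bf _ _ ss').
congr (_ + _ * (_ - _)).
by apply: (dep_on_avg q (x := y) bf) => z /= /andP[zb _]; exact: ss'.
Qed.

Lemma transition_dep f : dep_on [in box] f -> dep_on [in box] (transition f).
Proof.
move=> bf s s' ss'; congr (_ * _); apply: eq_bigr => y _.
exact: site_update_dep bf _ _ ss'.
Qed.

(** Where the update at [y] is allowed, [g] does not depend on [s y] and comes out of the average.
    Used with [g = 1] and with the event that the origin stays unfilled. *)
Lemma mean_transition (g f : (site -> bool) -> R) :
  (forall y s b, y \in box -> c_box s y -> g (upd s y b) = g s) ->
  mean q box (fun s => g s * transition f s) = mean q box (fun s => g s * f s).
Proof.
move=> gc.
have -> : (fun s => g s * transition f s) =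
    (fun s => N%:R^-1 * \sum_(y <- box) g s * site_update y f s).
  by apply/funext => s; rewrite -mulr_sumr mulrCA.
rewrite meanZ mean_sum.
have step y : y \in box -> mean q box (fun s => g s * site_update y f s) =
                         mean q box (fun s => g s * f s).
  move=> yb; apply/eqP; rewrite -subr_eq0 -meanB -(mean_avg q _ yb).
  rewrite -(mean_cst q box 0); apply/eqP/eq_mean => s.
  rewrite /site_update /avg !c_box_indep !updK.
  case: (boolP (c_box s y)) => cy /=; last by ring.
  by rewrite !(gc _ _ _ yb cy); ring.
rewrite (eq_big_seq _ step) big_const_seq count_predT iter_addr_0 -/N.
by rewrite -[X in _ * X]mulr_natl mulrA mulVf ?mul1r// gt_eqF.
Qed.

Definition box_form f : R :=
  q * (1 - q) * \sum_(y <- box) mean q box (fun s => (c_box s y)%:R * grad y f s ^+ 2).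

(** Given the other sites, an update is either the identity or the projection [avg q y], so
    Pythagoras gives its exact loss; the square of the mean over [y] is at most the mean of the
    squares. *)
Lemma transition_sqr f :
  mean q box (fun s => transition f s ^+ 2) <=
  mean q box (fun s => f s ^+ 2) - N%:R^-1 * box_form f.
Proof.
have step y : y \in box -> mean q box (fun s => site_update y f s ^+ 2) =
    mean q box (fun s => f s ^+ 2) -
    q * (1 - q) * mean q box (fun s => (c_box s y)%:R * grad y f s ^+ 2).
  move=> yb; apply/eqP; rewrite eq_sym subr_eq -subr_eq0 opprD addrA -meanB -meanZ.
  rewrite subr_eq0; apply/eqP; rewrite -(mean_avg q _ yb); apply: eq_mean => s.
  rewrite /site_update /avg !c_box_indep !updK /grad.
  by case: (c_box s y) => /=; ring.
have pt s : transition f s ^+ 2 <= N%:R^-1 * \sum_(y <- box) site_update y f s ^+ 2.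
  rewrite /transition exprMn expr2 -mulrA ler_pM2l ?invr_gt0//.
  by rewrite mulrC ler_pdivrMr// mulrC sqr_sum_le.
apply: le_trans (ler_mean q01' box pt) _; rewrite meanZ mean_sum.
rewrite (eq_big_seq _ step) sumrB big_const_seq count_predT iter_addr_0 -/N.
rewrite mulrBr -[X in _ * X - _]mulr_natl mulrA mulVf ?mul1r ?gt_eqF//.
by rewrite -mulr_sumr.
Qed.

(** The expected state of the origin after [m] steps of the chain started from [s]. *)
Definition state m := iter m transition (fun s => (s 0)%:R).

Lemma state_dep m : dep_on [in box] (state m).
Proof.
elim: m => [|m IH]; last exact: transition_dep.
by move=> s s' ss' /=; rewrite ss'// cone0_in.
Qed.

Lemma mean_state m : mean q box (state m) = q.
Proof.
have one f : mean q box f = mean q box (fun s => 1 * f s).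
  by apply: eq_mean => s; rewrite mul1r.
elim: m => [|m IH]; last by rewrite one mean_transition// -one.
rewrite -(mean_avg q _ (cone0_in XX v n)) -[RHS](mean_cst q box).
by apply: eq_mean => s; rewrite /= /avg !upd_same /=; ring.
Qed.

(** On the invariant event [closed_at n] the origin never gets filled, so the covariance of
    [state m] with this event is [- (q * theta XX v n q)] for every [m]; Cauchy-Schwarz then bounds
    the variance from below. *)
Lemma variance_state m : (q * theta XX v n q) ^+ 2 <=
  mean q box (fun s => state m s ^+ 2) - mean q box (state m) ^+ 2.
Proof.
pose g := closed_at (R := R) XX v n.
have gf0 : mean q box (fun s => g s * state m s) = 0.
  elim: m => [|m <-]; last first.
    rewrite mean_transition// => y s b yb cy; rewrite /g /closed_at.
    by rewrite (fill_upd_restrict chomo _ co yb cy).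
  rewrite -(mean_cst q box 0); apply: eq_mean => s.
  by rewrite /g (closed_blocked nbrs_ht) /=; case: (s 0); rewrite ?mul0r ?mulr0.
have cov : mean q box (fun s => (state m s - q) * g s) = - (q * theta XX v n q).
  rewrite (eq_mean q _ (g := fun s => g s * state m s - q * g s)); last by move=> s; ring.
  by rewrite meanB meanZ gf0 sub0r.
rewrite -sqrrN -cov mean_state.
apply: le_trans (av_CauchySchwarz q01' _ _ _ _) _.
rewrite -/(mean q box _) -/(mean q box (fun s => g s ^+ 2)).
rewrite (eq_mean q _ (f := fun s => (state m s - q) ^+ 2)
   (g := fun s => state m s ^+ 2 + (- (2 * q) * state m s + q ^+ 2))); last by move=> s; ring.
rewrite !meanD meanZ mean_cst mean_state.
have -> : mean q box (fun s => state m s ^+ 2) + (- (2 * q) * q + q ^+ 2) =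
  mean q box (fun s => state m s ^+ 2) - q ^+ 2 by ring.
rewrite ler_piMr//.
  rewrite -[X in _ - X ^+ 2](mean_state m) subr_ge0.
  exact: av_jensen.
rewrite -[leRHS](mean_cst q box) ler_mean// => s.
by rewrite expr_le1// ?closed_le1 ?closed_ge0.
Qed.

(** The second moment is at most 1 initially and each step costs it at least
    [box_form (state m) / N]; if all these forms exceeded [h%:R^-1], it would be negative after
    [h * N] steps. *)
Lemma small_box_form (h : nat) : (0 < h)%N ->
  exists2 m, (m < h * N)%N & box_form (state m) <= h%:R^-1.
Proof.
move=> h0; have hR : 0 < h%:R :> R by rewrite ltr0n.
apply: contrapT => H.
have big m : (m < h * N)%N -> h%:R^-1 < box_form (state m).
  by move=> mh; rewrite ltNge; apply/negP => le; apply: H; exists m.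
have tele m : mean q box (fun s => state m s ^+ 2) <=
    1 - N%:R^-1 * \sum_(k < m) box_form (state k).
  elim: m => [|m IH].
    rewrite big_ord0 mulr0 subr0 -[leRHS](mean_cst q box) ler_mean// => s.
    by rewrite /=; case: (s 0); rewrite ?expr0n ?expr1n.
  apply: le_trans (transition_sqr _) _.
  by rewrite big_ord_recr/= mulrDr opprD addrA lerD2r.
have sumgt : \sum_(k < h * N) h%:R^-1 < \sum_(k < h * N) box_form (state k).
  apply: ltr_sum; last by move=> i _; exact: big.
  have hN0 : (0 < h * N)%N by rewrite muln_gt0 h0.
  by apply/hasP; exists (Ordinal hN0); rewrite ?mem_index_enum.
have sumE : \sum_(k < h * N) h%:R^-1 = N%:R :> R.
  by rewrite sumr_const card_ord mulrnA -[_ *+ h]mulr_natr mulVf ?gt_eqF.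
rewrite sumE in sumgt.
have : mean q box (fun s => state (h * N) s ^+ 2) < 0.
  apply: le_lt_trans (tele _) _; rewrite subr_lt0 -(ltr_pM2l NR) mulrA mulfV ?gt_eqF//.
  by rewrite mul1r mulr1.
by rewrite ltNge mean_ge0// => s; exact: sqr_ge0.
Qed.

(* [influence m x] bounds the effect of flipping [x] on [state m]; it spreads at
   finite speed, so it is tiny near the boundary of [box] if [m] is of order
   [N] and [n] is large. *)
Fixpoint influence (m : nat) (x : site) : R :=
  if m is m'.+1 then influence m' x +
    N%:R^-1 * \sum_(y <- box | nbh XX y x) influence m' y
  else (x == 0)%:R.

Lemma influence_ge0 m x : 0 <= influence m x.
Proof.
elim: m x => [|m IH] x /=; first exact: ler0n.
by rewrite addr_ge0// mulr_ge0 ?invr_ge0 ?ler0n// sumr_ge0.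
Qed.

(** Flipping [x] can change whether the update at [y] is allowed only if [y] reads [x]; the two
    results then differ by one extra move at [y], of size at most [b y]. *)
Lemma site_update_grad (f : (site -> bool) -> R) (b : site -> R) x y s :
  (forall x s, `|grad x f s| <= b x) ->
  `|grad x (site_update y f) s| <= b x + (nbh XX y x)%:R * b y.
Proof.
move=> fb; have b0 z : 0 <= b z by apply: le_trans (fb z s).
have /andP[q0 q1] := q01'; have p0 : 0 <= 1 - q by rewrite subr_ge0.
have avgb : x != y -> forall s, `|avg q y f (upd s x true) - avg q y f (upd s x false)| <= b x.
  move=> xy s'; rewrite -/(grad x (avg q y f) s') grad_avg//.
  have -> : b x = q * b x + (1 - q) * b x by ring.
  rewrite /avg (le_trans (ler_normD _ _))// !normrM !(ger0_norm q0, ger0_norm p0).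
  by rewrite lerD// ler_wpM2l.
have devb s' : `|avg q y f s' - f s'| <= b y.
  rewrite distrC sub_avg normrM; apply: le_trans (fb y s').
  rewrite ler_piMl//; case: (s' y) => /=; first by rewrite ger0_norm// gerBl.
  by rewrite sub0r normrN ger0_norm.
rewrite /grad /site_update.
have [->|xy] := eqVneq x y.
  rewrite !c_box_indep (negPf (nbh_irr nbrs_ht y)) mul0r addr0.
  have -> : avg q y f (upd s y true) = avg q y f (upd s y false).
    by rewrite !indep_avg.
  case: (c_box s y) => /=; rewrite ?mul0r ?mul1r ?addr0; last exact: fb.
  by rewrite [X in `|X|](_ : _ = 0) ?normr0//; ring.
have [yx|yx] := boolP (nbh XX y x); last first.
  rewrite mul0r addr0.
  have ci b' : c_box (upd s x b') y = c_box s y.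
    apply: (c_dep chomo) => z yz; rewrite updE; case: eqP => // zx.
    by move: yx; rewrite -zx yz.
  rewrite !ci; case: (c_box s y) => /=; rewrite ?mul0r ?mul1r ?addr0; last exact: fb.
  by rewrite ![f _ + _]addrC !subrK avgb.
rewrite mul1r.
have fx := fb x s; rewrite /grad in fx.
have dt := devb (upd s x true); have df := devb (upd s x false).
case: (c_box _ y); case: (c_box _ y); rewrite /= ?mul0r ?mul1r ?addr0.
- rewrite ![f _ + _]addrC !subrK; apply: le_trans (avgb xy s) _.
  by rewrite lerDl.
- by rewrite addrAC; apply: le_trans (ler_normD _ _) _; exact: lerD.
- rewrite opprD addrA; apply: le_trans (ler_normB _ _) _; exact: lerD.
- by apply: le_trans fx _; rewrite lerDl.
Qed.

Lemma state_grad m x s : `|grad x (state m) s| <= influence m x.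
Proof.
elim: m x s => [|m IH] x s.
  rewrite /grad /= !updE eq_sym; case: eqP => _ /=; first by rewrite subr0 normr1.
  by rewrite subrr normr0.
have -> : grad x (state m.+1) s =
    N%:R^-1 * \sum_(y <- box) grad x (site_update y (state m)) s.
  by rewrite /grad -mulrBr -sumrB.
rewrite normrM ger0_norm ?invr_ge0 ?ler0n// mulrC ler_pdivrMr// mulrDl.
apply: le_trans (ler_norm_sum _ _ _) _.
apply: le_trans (_ : _ <= \sum_(y <- box) (influence m x + (nbh XX y x)%:R * influence m y)) _.
  by apply: ler_sum => y _; apply: site_update_grad => z s'; exact: IH.
rewrite big_split/= big_const_seq count_predT iter_addr_0 -/N mulr_natr lerD2l.
rewrite mulrAC mulVf ?gt_eqF// mul1r [leRHS]big_mkcond/=; apply: ler_sum => y _.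
by case: (nbh XX y x); rewrite ?mul1r ?mul0r.
Qed.

Definition spread : R := (size (nbrs XX))%:R * 2 ^+ reach XX v.

(** The exponential weights turn a bound on this sum into smallness of the influence near the top of
    the box. *)
Definition total_influence m : R := \sum_(x <- box) 2 ^+ `|ht x|%N * influence m x.

(** Each step multiplies the total by at most [1 + N%:R^-1 * spread], since a site passes influence
    to at most [size (nbrs XX)] sites whose heights differ from its own by at most [reach]. The
    resulting bound does not depend on the size of the box. *)
Lemma total_influence_le (h m : nat) : (m <= h * N)%N ->
  total_influence m <= expR (spread * h%:R).
Proof.
have sp0 : 0 <= spread by rewrite mulr_ge0 ?ler0n ?exprn_ge0.
have step k : total_influence k <= (1 + N%:R^-1 * spread) ^+ k.
  elim: k => [|k IH].
    rewrite expr0 /total_influence (bigD1_seq 0) ?cone0_in//= eqxx ht0 mulr1 expr0.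
    rewrite big1 ?addr0// => x x0; rewrite (negPf x0) mulr0//.
  rewrite exprSr; apply: le_trans (ler_wpM2r _ IH); last first.
    by rewrite addr_ge0// mulr_ge0 ?invr_ge0 ?ler0n.
  rewrite /total_influence /= mulrDr mulr1.
  rewrite (eq_bigr (fun x => 2 ^+ `|ht x|%N * influence k x +
     N%:R^-1 * \sum_(y <- box | nbh XX y x) 2 ^+ `|ht x|%N * influence k y)); last first.
    by move=> x _; rewrite mulrDr -mulr_sumr mulrCA.
  rewrite big_split/= lerD2l -mulr_sumr mulrCA ler_wpM2l ?invr_ge0 ?ler0n//.
  rewrite (exchange_big_dep xpredT)//= mulr_suml big_seq [leRHS]big_seq.
  apply: ler_sum => y yb; rewrite -mulr_suml mulrAC ler_wpM2r ?influence_ge0//.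
  apply: le_trans (_ : _ <= \sum_(x <- box | nbh XX y x) 2 ^+ `|ht y|%N * 2 ^+ reach XX v) _.
    rewrite big_seq_cond [leRHS]big_seq_cond; apply: ler_sum => x /andP[xb yx].
    rewrite -exprD ler_eXn2l ?ltr1n//.
    have xr : (absz (ht (x - y)) <= reach XX v)%N := absz_ht_nbrs v yx.
    have hE : ht x = ht y + ht (x - y) by rewrite -htD addrC subrK.
    by rewrite hE absz_add_le.
  rewrite big_const_seq iter_addr_0 -[leLHS]mulr_natl mulrCA ler_wpM2l ?exprn_ge0//.
  rewrite /spread ler_wpM2r ?exprn_ge0// ler_nat -size_filter.
  rewrite -(size_map (fun z => y + z) (nbrs XX)); apply: uniq_leq_size.
    by rewrite filter_uniq.
  move=> x; rewrite mem_filter => /andP[yx _]; apply/mapP; exists (x - y) => //.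
  by rewrite addrC subrK.
move=> mh; apply: le_trans (step m) _.
apply: le_trans (_ : _ <= expR (N%:R^-1 * spread) ^+ m) _.
  by rewrite lerXn2r ?nnegrE ?expR_ge0 ?expR_ge1Dx// addr_ge0// mulr_ge0 ?invr_ge0 ?ler0n.
rewrite -expRM_natr ler_expR mulrAC mulrC ler_wpM2l// mulrC ler_pdivrMr//.
by rewrite -natrM ler_nat.
Qed.

(** Up to height [n - reach] the constraint sees only the box and agrees with [c_box]. Above that,
    one factor of the squared gradient is at most [del], and the other is summed by the total
    influence. *)
Lemma form_state_le (h m : nat) (L : seq site) : {subset box <= L} ->
  (m <= h * N)%N ->
  q * (1 - q) * \sum_(x <- box) mean q L (fun s => (c s x)%:R * grad x (state m) s ^+ 2)
  <= box_form (state m) + expR (spread * h%:R) ^+ 2 * 2 ^+ reach XX v / 2 ^+ n.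
Proof.
move=> bL mh; set W := expR _.
have W0 : 0 <= W by exact: expR_ge0.
have tot : total_influence m <= W := total_influence_le mh.
pose del := W * 2 ^+ reach XX v / 2 ^+ n.
have p2 k : 0 < (2 : R) ^+ k by exact: exprn_gt0.
have del0 : 0 <= del by rewrite divr_ge0 ?mulr_ge0 ?exprn_ge0.
have infl_box x : x \in box -> 2 ^+ absz (ht x) * influence m x <= W.
  move=> xb; apply: le_trans tot; rewrite /total_influence (bigD1_seq x)//= lerDl.
  by rewrite sumr_ge0// => y _; rewrite mulr_ge0 ?influence_ge0// exprn_ge0.
have infl_sum : \sum_(x <- box) influence m x <= W.
  apply: le_trans tot; apply: ler_sum => x _.
  by rewrite ler_peMl ?influence_ge0// exprn_ege1// ler1n.
have bdry x : x \in box -> n%:Z < ht x + (reach XX v)%:Z -> influence m x <= del.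
  move=> xb hx; rewrite /del ler_pdivlMr// mulrC.
  apply: le_trans (_ : _ <= 2 ^+ (absz (ht x) + reach XX v) * influence m x) _.
    rewrite ler_wpM2r ?influence_ge0// ler_weXn2l ?ler1n//.
    have : 0 <= ht x by move: xb; rewrite mem_cone => /andP[/in_coneP[]].
    by move: hx; move: (ht x) (reach XX v) => a r; clear; lia.
  by rewrite exprD mulrAC ler_wpM2r ?exprn_ge0// infl_box.
have term x : x \in box ->
    mean q L (fun s => (c s x)%:R * grad x (state m) s ^+ 2) <=
    mean q box (fun s => (c_box s x)%:R * grad x (state m) s ^+ 2) +
    del * influence m x.
  move=> xb; have gd : dep_on [in box] (grad x (state m)).
    by move=> s s' ss'; rewrite /grad; congr (_ - _); apply: state_dep => z zb;
      rewrite !updE ss'.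
  rewrite -(mean_supp q _ bL); last first.
    by move=> s s' ss'; rewrite (gd _ _ ss') (c_box_dep x ss').
  have [hx|hx] := leP (ht x + (reach XX v)%:Z) n%:Z.
    rewrite (eq_mean q _ (g := fun s => (c_box s x)%:R * grad x (state m) s ^+ 2)).
      by rewrite lerDl mulr_ge0 ?influence_ge0.
    move=> s; congr (_%:R * _); congr nat_of_bool; apply: (c_dep chomo) => z xz.
    suff -> : z \in box by rewrite andbT.
    have zE : z = x + (z - x) by rewrite addrC subrK.
    rewrite zE cone_nbrs// -zE (le_trans _ hx)//.
    have : (absz (ht (z - x)) <= reach XX v)%N := absz_ht_nbrs v xz.
    have -> : ht z = ht x + ht (z - x) by rewrite -htD -zE.
    by rewrite lerD2l -lez_nat abszE; apply: le_trans; exact: ler_norm.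
  rewrite -[leLHS]add0r lerD//.
    by rewrite mean_ge0// => s; rewrite mulr_ge0 ?ler0n ?sqr_ge0.
  rewrite -[leRHS](mean_cst q L) ler_mean// => s.
  apply: le_trans (_ : _ <= grad x (state m) s ^+ 2) _.
    by rewrite ler_piMl ?sqr_ge0// lern1 leq_b1.
  rewrite -real_normK ?num_real// expr2.
  by rewrite ler_pM// ?state_grad// (le_trans (state_grad _ _ _))// bdry.
apply: le_trans (_ : _ <= q * (1 - q) * \sum_(x <- box)
    (mean q box (fun s => (c_box s x)%:R * grad x (state m) s ^+ 2) + del * influence m x)) _.
  rewrite ler_wpM2l// big_seq [leRHS]big_seq; exact: ler_sum.
rewrite big_split/= mulrDr lerD2l -mulr_sumr.
apply: le_trans (_ : _ <= 1 * (del * W)) _.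
  rewrite ler_pM// ?mulr_ge0//; first by rewrite sumr_ge0// => x _; exact: influence_ge0.
  by rewrite ler_wpM2l.
have alg (w a b : R) : w * a / b * w = w ^+ 2 * a / b by ring.
by rewrite mul1r /del alg.
Qed.

End subcritical.

(** * Test functions with a small Rayleigh quotient *)

Section subcritical_gap.
Context {R : realType} {d : nat}.
Local Notation site := 'rV[int]_d.
Variables (XX : {fset {fset site}}) (v : site).
Hypothesis nbrs_ht : forall y, y \in nbrs XX -> 0 < ht v y.
Local Notation c := (constraint XX).
Local Notation cone := (cone XX v).

Lemma spectral_gap_ge0 (q : R) : 0 <= q <= 1 -> (0 <= spectral_gap XX q)%E.
Proof.
move=> q01; have /andP[q0 q1] := q01.
apply: le_ereal_inf_tmp => _ [f [[S Sf] V0] <-].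
pose L := enum_fset S ++ flatten [seq [seq x + y | y <- nbrs XX] | x <- S].
have SL : {subset S <= L} by move=> x xS; rewrite mem_cat [x \in _]xS.
have XL x (X : {fset site}) y : x \in S -> X \in XX -> y \in X -> x + y \in L.
  move=> xS XXX yX; rewrite mem_cat; apply/orP; right.
  by apply/flatten_mapP; exists x => //; apply: map_f; exact: nbrsP yX.
have [V0' ->] := rayleigh nbrs_ht q01 Sf SL XL V0.
rewrite lee_fin divr_ge0 ?(ltW V0')// !mulr_ge0 ?subr_ge0// sumr_ge0// => x _.
by apply: mean_ge0 => // s; rewrite mulr_ge0 ?ler0n ?sqr_ge0.
Qed.

(** Transfers small values of [theta] to bootstrap percolation, so below criticality [theta] must
    stay bounded away from 0. *)
Lemma unfilled_theta (q : R) n : 0 <= q <= 1 ->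
  unfilled XX q (size (cone n)) <= theta XX v n q.
Proof.
move=> q01; set t := size _; pose L := cone n ++ past XX t 0.
rewrite /theta -(mean_supp (l' := L) q (@closed_dep R _ XX v n)); last first.
  by move=> x xn; rewrite mem_cat xn.
rewrite /unfilled -(mean_supp (l' := L) q (f := fun s => (bootstrap XX t s 0 != true)%:R)).
- apply: ler_mean => // s; rewrite /closed_at ler_nat.
  case: (boolP (fill c (cone n) s 0)) => [/(fill_bootstrap (XX := XX))|_].
    by rewrite -/t => ->.
  by rewrite leq_b1.
- by move=> s s' ss'; rewrite (bootstrap_dep ss').
- by move=> x xn; rewrite mem_cat xn orbT.
Qed.

Lemma subcritical_gap (q : R) : 0 < q -> q < q_c XX -> spectral_gap XX q = 0%E.
Proof.
move=> q0 qc.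
have lb : has_lbound (critical_set XX : set R) by exists 0 => r [/andP[]].
have q1 : q < 1 := lt_le_trans qc (ge_inf lb (critical_set1 XX)).
have q01 : 0 < q < 1 by rewrite q0.
have q01' : 0 <= q <= 1 by rewrite !ltW.
have [p0 p00 p0P] : exists2 p0 : R, 0 < p0 & forall n, p0 <= theta XX v n q.
  apply: contrapT => H; have : critical_set XX q.
    split=> //; apply/(unfilled_cvg0P XX q01') => e e0.
    apply: contrapT => H'; apply: H; exists e => // n.
    apply: le_trans (unfilled_theta n q01'); rewrite leNgt; apply/negP => lt.
    by apply: H'; exists (size (cone n)); exact: ltW.
  by move=> /(ge_inf lb); rewrite leNgt -/(q_c XX) qc.
pose v0 := (q * p0) ^+ 2.
have v00 : 0 < v0 by rewrite exprn_gt0// mulr_gt0.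
suff small (e : R) : 0 < e -> (spectral_gap XX q <= e%:E)%E.
  apply/eqP; rewrite eq_le spectral_gap_ge0// andbT leNgt; apply/negP.
  case: (spectral_gap XX q) small => [r||] small //=.
    rewrite lte_fin => r0; have r20 : 0 < r / 2 by rewrite divr_gt0.
    have := small _ r20.
    by rewrite lee_fin; lra.
  by have := small 1 ltr01.
move=> e0.
have ev0 : 0 < e * v0 / 2 by rewrite divr_gt0// mulr_gt0.
(* [h] is fixed first, from the target [e]. The boundary constant [W] depends on [h] but not on [n],
   so [n] can be taken large afterwards. *)
pose h := (Num.trunc (e * v0 / 2)^-1).+1.
have hP : h%:R^-1 <= e * v0 / 2.
  by rewrite invf_ple ?posrE ?ltr0n// ltW// truncnS_gt.
pose W : R := expR (spread XX v * h%:R) ^+ 2 * 2 ^+ reach XX v.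
have W0 : 0 < W by rewrite mulr_gt0 ?exprn_gt0 ?expR_gt0.
pose n := (Num.trunc (W / (e * v0 / 2))).+1.
have nP : W / 2 ^+ n <= e * v0 / 2.
  rewrite ler_pdivrMr ?exprn_gt0// mulrC -ler_pdivrMr//.
  apply: le_trans (ltW (truncnS_gt _)) _; rewrite -/n -natrX ler_nat ltnW//.
  exact: ltn_expl.
have [m mh formP] := small_box_form nbrs_ht n q01 (ltn0Sn _ : (0 < h)%N).
pose f : config site -> R := state XX v q n m.
pose S : {fset site} := [fset x in cone n]%fset.
have SE : S =i cone n by move=> x; rewrite !inE.
have Sf : dep_on [in S] f.
  by apply: sub_dep_on (@state_dep R d XX v q n m) => x; rewrite /= SE.
pose L := cone n ++ flatten [seq [seq x + y | y <- nbrs XX] | x <- cone n].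
have bL : {subset cone n <= L} by move=> x xS; rewrite mem_cat [x \in _]xS.
have SL : {subset S <= L} by move=> x; rewrite SE; exact: bL.
have XL x (X : {fset site}) y : x \in S -> X \in XX -> y \in X -> x + y \in L.
  rewrite SE => xS XXX yX; rewrite mem_cat; apply/orP; right.
  by apply/flatten_mapP; exists x => //; apply: map_f; exact: nbrsP yX.
have Vn : v0 <= mean q L (fun s => f s ^+ 2) - mean q L f ^+ 2.
  have Lf g : dep_on [in cone n] g -> mean q L g = mean q (cone n) g.
    by move=> gd; rewrite (mean_supp q gd bL).
  rewrite !Lf; last 2 first.
  - exact: state_dep.
  - by move=> s s' ss'; rewrite /f (state_dep _ _ ss').
  apply: le_trans (variance_state nbrs_ht n q01 m).
  rewrite lerXn2r ?nnegrE ?mulr_ge0 ?(ltW q0) ?(ltW p00) ?theta_ge0//.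
  by rewrite ler_wpM2l ?(ltW q0).
have V0 : (0 < 'V_(bernoulli_product q)[f])%E.
  have Lf : dep_on [in L] f by apply: sub_dep_on Sf => x; exact: SL.
  by rewrite (variance_mean q01' Lf) lte_fin (lt_le_trans v00).
apply: le_trans (_ : _ <= (- 'E_(bernoulli_product q)[f \* generator XX q f] /
   'V_(bernoulli_product q)[f]))%E _.
  apply: ereal_inf_lbound; exists f => //; split=> //; exists S => s s' ss'.
  exact: Sf.
have [V0' ->] := rayleigh nbrs_ht q01' Sf SL XL V0.
rewrite lee_fin ler_pdivrMr//; apply: le_trans (_ : _ <= e * v0) _; last first.
  by rewrite ler_wpM2l// ltW.
have -> : \sum_(x <- S) mean q L (fun s => (c s x)%:R * grad x f s ^+ 2) =
   \sum_(x <- cone n) mean q L (fun s => (c s x)%:R * grad x f s ^+ 2).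
  by apply: perm_big; apply: uniq_perm => //; exact: cone_uniq.
apply: le_trans (form_state_le nbrs_ht q01 bL (ltnW mh)) _.
rewrite -/W; have -> : e * v0 = e * v0 / 2 + e * v0 / 2 by field.
by rewrite lerD// (le_trans formP).
Qed.

End subcritical_gap.

(** At [q = 0] no local function has positive variance and the gap is the infimum of an empty set,
    which is why the second range excludes this value. *)
Theorem corollary1p8 (R : realType) (d : nat) (XX : {fset {fset 'rV[int]_d}}) :
  (1 <= d)%N ->
  update_family XX ->
  in_half_space (R := R) XX ->
  (forall q : R, 0 <= q <= 1 -> q_c XX < q -> (0 < spectral_gap XX q)%E) /\
  (forall q : R, 0 < q <= 1 -> q < q_c XX -> spectral_gap XX q = 0%E).
Proof.
move=> _ _ [u Xu].
have [v nv] : exists v : 'rV[int]_d, forall y, y \in nbrs XX -> 0 < ht v y.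
  by apply: (integer_direction (u := u)) => y /nbrs_inv[X XXX]; exact: Xu.
split=> q; first exact: (supercritical_gap nv).
by move=> /andP[q0 _]; exact: (subcritical_gap nv).
Qed.
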